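(* Let $p>1$, $H>0$, $0<\varphi<\pi/2$, and let $f\in L^1(-1,1)$ satisfy Hypothesis (HF). Then every weak solution $u$ to problem (P) satisfies $u\in C^1[-1,1]$.
   Context: Problem (P) is the boundary value problem $-\frac{d}{dx}\big[(u(x)+H)\,|u'(x)\cos\varphi+\sin\varphi|^{p-2}(u'(x)\cos\varphi+\sin\varphi)\big]=f(x)$ for $x\in(-1,1)$, $u(-1)=u(1)=0$. Convention: $|z|^{p-2}z=0$ at $z=0$. A weak solution to (P) is a function $u\in W_0^{1,p}(-1,1)$ with $u\ge -H$ such that $\int_{-1}^1 (u+H)|u'\cos\varphi+\sin\varphi|^{p-2}(u'\cos\varphi+\sin\varphi)\,v'\,dx=\int_{-1}^1 f v\,dx$ for all $v\in W_0^{1,p}(-1,1)$ (weak derivatives). Functions in $W^{1,p}_0(-1,1)$ are identified with their absolutely continuous representatives on $[-1,1]$. Hypothesis (HF): $f\in L^1(-1,1)$ and $\min_{x_0\in[-1,1]}\min_{x\in[x_0,1]}\Big(H^{\frac{p}{p-1}}+\frac{p}{(p-1)\cos\varphi}\int_x^1\Phi_{p'}\big(\int_{x_0}^{\tau}f(s)\,ds\big)d\tau\Big)>0$, where $1/p+1/p'=1$ and $\Phi_q(z)=|z|^{q-1}\operatorname{sign}z$ for $q>1$. *)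

(* Defs.v *)
From HB Require Import structures.
From mathcomp Require Import all_boot all_order all_algebra.
From mathcomp Require Import all_classical all_reals all_analysis.
Set Implicit Arguments.
Unset Strict Implicit.
Unset Printing Implicit Defensive.
Import Order.TTheory GRing.Theory Num.Theory.
Import numFieldNormedType.Exports.
Local Open Scope classical_set_scope.
Local Open Scope ring_scope.

Section Defs.
Context {R : realType}.
Implicit Types (f g u v du dv phi : R -> R) (p q H x : R).

Local Notation mu := (@lebesgue_measure R).

Definition Omega : set R := `](-1), 1[.

(* Elements of Lp are represented by Borel functions on Omega, extended by 0;
   equality almost everywhere is never quotiented out. *)
Definition Lp p f : Prop := f \_ Omega \in Lfun mu p%:E.

Definition Lp_norm p f : \bar R := 'N[mu]_(p%:E) [EFin \o (f \_ Omega)].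

Definition test_function phi : Prop :=
  (forall (n : nat) x, derivable (derive1n n phi) x 1) /\
  (exists2 K : set R, compact K /\ K `<=` Omega & forall x, ~ K x -> phi x = 0).

Definition weak_derivative u du : Prop :=
  forall phi, test_function phi ->
    \int[mu]_(x in Omega) (u x * derive1 phi x) =
    - \int[mu]_(x in Omega) (du x * phi x).

Definition absolutely_continuous (a b : R) u : Prop :=
  forall e : R, 0 < e -> exists2 d : R, 0 < d &
    forall (n : nat) (s t : 'I_n -> R),
      (forall i, [/\ a <= s i, s i <= t i & t i <= b]) ->
      trivIset [set: 'I_n] (fun i => `]s i, t i[%classic) ->
      \sum_(i < n) (t i - s i) < d ->
      \sum_(i < n) `|u (t i) - u (s i)| < e.

Definition W1p p u du : Prop := [/\ Lp p u, Lp p du & weak_derivative u du].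

(* [W01p p u du]: u is the absolutely continuous representative on [-1, 1] of
   an element of the W^{1,p}-closure of the test functions, and du is its weak
   derivative (determined almost everywhere). *)
Definition W01p p u du : Prop :=
  [/\ absolutely_continuous (-1) 1 u,
      W1p p u du &
      exists phi : nat -> R -> R,
        [/\ forall n, test_function (phi n),
            Lp_norm p (fun x => phi n x - u x) @[n --> \oo] --> 0%E &
            Lp_norm p (fun x => derive1 (phi n) x - du x) @[n --> \oo] --> 0%E]].

(* At z = 0 this is 0 for every p, as required by the convention
   |z|^{p-2} z = 0. *)
Definition plap p (z : R) : R := `|z| `^ (p - 2) * z.

Definition Phi q (z : R) : R := `|z| `^ (q - 1) * Num.sg z.

Definition weak_solution p H (varphi : R) f u : Prop :=
  exists du, [/\ W01p p u du,
    forall x, x \in `[-1, 1] -> - H <= u x &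
    forall v dv, W01p p v dv ->
      \int[mu]_(x in Omega)
        ((u x + H) * plap p (du x * cos varphi + sin varphi) * dv x) =
      \int[mu]_(x in Omega) (f x * v x)].

Definition HF_fun p p' H (varphi : R) f (x0 x : R) : R :=
  H `^ (p / (p - 1)) +
  p / ((p - 1) * cos varphi) *
    \int[mu]_(tau in `[x, 1]) Phi p' (\int[mu]_(s in `[x0, tau]) f s).

(* HF_fun is continuous when f is integrable, so both minima are attained and
   are the infima below. *)
Definition HF p p' H (varphi : R) f : Prop :=
  mu.-integrable Omega (EFin \o f) /\
  0 < inf [set inf [set HF_fun p p' H varphi f x0 x | x in `[x0, 1]]
          | x0 in `[-1, 1]].

(* Difference quotients are taken inside [a, b], hence one-sided at a and b. *)
Definition C1_on (a b : R) u : Prop :=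
  exists2 g : R -> R, {within `[a, b], continuous g} &
    forall x, x \in `[a, b] ->
      (u y - u x) / (y - x) @[y --> within `[a, b] (x^')] --> g x.

End Defs.

(* Main.v *)
(* Write w = u + H and G = c - \int_{-1}^x f.  Testing the weak formulation
   against primitives of bump functions (du Bois-Reymond) gives the flux
   equation  w |z|^(p-2) z = G  almost everywhere, with z = u' cos + sin.
   Where w > 0 it can be solved for u', which is then continuous; so the point
   is that w has no zero.  At a zero s one has G(s) = 0: if G(s) < 0 then u' < 0
   just to the right of s, and if G(s) > 0 then u' > 0 just to the left of s
   (there w |z|^(p-2) z > w forces z > 1 >= sin), and either way w would be
   negative near s.  Taking s to be the last zero, the flux equation raised to
   the power 1/(p-1) reads
     (p-1)/p cos (w^(p/(p-1)))' + sin w^(1/(p-1)) = Phi_p'(G)  on (s, 1],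
   and integrating it from s to 1 contradicts (HF) at x_0 = x = s. *)
Require Import Defs.
From HB Require Import structures.
From mathcomp Require Import all_boot all_order all_algebra.
From mathcomp Require Import all_classical all_reals all_analysis.
From mathcomp Require Import measurable_realfun ring lra.
Set Implicit Arguments.
Unset Strict Implicit.
Unset Printing Implicit Defensive.
Import Order.TTheory GRing.Theory Num.Theory.
Import numFieldNormedType.Exports.
Local Open Scope classical_set_scope.
Local Open Scope ring_scope.

(** * Smooth bump functions *)

Section Smooth.
Context {R : realType}.
Implicit Types (f g : R -> R) (P Q : {poly R}) (x y a b k : R).

(** The obstacle is that [du] is known only almost everywhere, and at a zero of w the flux equation
    says nothing about u'. The constant c produced by du Bois-Reymond is unknown, whereas (HF) sees
    only differences of G. A zero s of w fixes it: G(s) = 0 makes the integral of f from s to t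
    equal to -G(t). Since w(-1) = w(1) = H > 0, such a zero lies inside the interval, and the term
    H^(p/(p-1)) of (HF) is w(1)^(p/(p-1)). Test functions must have derivatives of every order, so
    du Bois-Reymond needs explicit C^infinity bumps. They are built from P(1/x) exp(-1/x) with P a
    polynomial, a family that differentiation maps into itself. *)

Definition flat P x : R := if 0 < x then P.[x^-1] * expR (- x^-1) else 0.

Lemma flat_le0 P x : x <= 0 -> flat P x = 0.
Proof. by move=> x0; rewrite /flat ltNge x0. Qed.

(** Termwise, t^(i+1) / (i+1)! <= e^t at t = 1/x; the spare power of t becomes the factor |x|, which
    yields continuity at 0. *)
Lemma flat_bound P : exists2 C, 0 <= C & forall x, `|flat P x| <= C * `|x|.
Proof.
exists (\sum_(i < size P) `|P`_i| * i.+1`!%:R).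
  by apply: sumr_ge0 => i _; rewrite mulr_ge0.
move=> x; rewrite /flat; case: ifPn => [x0|_]; last first.
  by rewrite normr0 mulr_ge0// sumr_ge0// => i _; rewrite mulr_ge0.
rewrite horner_coef mulr_suml mulr_suml (le_trans (ler_norm_sum _ _ _))//.
apply: ler_sum => i _.
rewrite !normrM -!mulrA ler_wpM2l// [`|expR _|]ger0_norm ?expR_ge0//.
rewrite !gtr0_norm ?exprn_gt0 ?invr_gt0//.
have h : x^-1 ^+ i.+1 <= i.+1`!%:R * expR x^-1.
  rewrite mulrC -ler_pdivrMr ?ltr0n ?fact_gt0//.
  have xi0 : 0 <= x^-1 by rewrite invr_ge0 ltW.
  have := expR_ge1Dxn i xi0; lra.
rewrite expRN ler_pdivrMr ?expR_gt0//.
rewrite exprS in h.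
by rewrite mulrAC mulrC -ler_pdivrMl//.
Qed.


(** For x > 0 the product rule gives x^-2 (P - P')(1/x) exp(-1/x), which is [flat] of 'X^2 * (P -
    P'). *)
Lemma is_derive_flat P x :
  is_derive x 1 (flat P) (flat ('X^2 * (P - P^`())) x).
Proof.
have [x0|x0|->] := ltgtP x 0.
- rewrite flat_le0 ?ltW//.
  apply: (@near_eq_is_derive _ _ _ (cst 0)) => //.
    near=> y; rewrite flat_le0//.
    near: y; exact: lt_le_nbhsl.
- rewrite {2}/flat x0.
  pose F y := P.[y^-1] * expR (- y^-1).
  apply: (@near_eq_is_derive _ _ _ F) => //.
    near=> y; rewrite /flat ifT//.
    near: y; exact: lt_nbhsr.
  have x0' : x != 0 by rewrite gt_eqF.
  have dV : is_derive x 1 (fun y : R => y^-1) (- x ^- 2).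
    apply: (is_derive_eq (is_deriveV x0' (@is_derive_id _ _ x (1:R)))).
    by rewrite -[LHS]/(_ * _) mulr1.
  have dP : is_derive x 1 (fun y : R => P.[y^-1]) (P^`().[x^-1] * - x ^- 2).
    by apply: (is_derive_eq (is_derive1_comp (is_derive_poly P x^-1) dV)).
  have dE : is_derive x 1 (fun y : R => expR (- y^-1)) (expR (- x^-1) * x ^- 2).
    apply: (is_derive_eq (@is_derive1_comp R expR (fun y => - y^-1) x _ _
      (is_derive_expR _) (is_deriveN dV))).
    by rewrite opprK.
  apply: (is_derive_eq (is_deriveM dP dE)).
  rewrite !hornerE /= /GRing.scale/=.
  rewrite -exprVn; ring.
(* At 0 the difference quotient of [flat P] is [flat ('X * P)], which tends to 0 by the linear
   bound. *)
- rewrite flat_le0//; apply/is_derive1_caratheodory.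
  exists (flat ('X * P)); split; last by rewrite flat_le0.
  + move=> z; rewrite [flat P 0]flat_le0// !subr0 /flat; case: ifPn => z0.
      by rewrite !hornerE/=; field; rewrite gt_eqF.
    by rewrite mul0r.
  + rewrite /prop_for /continuous_at [flat _ 0]flat_le0//.
    have [C C0 hC] := flat_bound ('X * P).
    apply/cvgr0Pnorm_lt => e e0; near=> y.
    (* [C + 1] replaces [C], which may vanish, so that it can be divided by. *)
    rewrite (le_lt_trans (hC y))// (@le_lt_trans _ _ ((C + 1) * `|y|))//.
      by rewrite ler_wpM2r// lerDl.
    rewrite -ltr_pdivlMl; last by rewrite ltr_wpDl.
    near: y; apply: (cvgr0_norm_lt id) => //.
    by rewrite mulr_gt0// invr_gt0 ltr_wpDl.
Unshelve. all: by end_near. Qed.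

(* Differentiation maps this class into itself, so its members are C^infinity. *)
Inductive smooth : (R -> R) -> Prop :=
| smooth_flat P a b : smooth (fun x => flat P (a * x + b))
| smooth_cst c : smooth (cst c)
| smooth_add f g : smooth f -> smooth g -> smooth (fun x => f x + g x)
| smooth_mul f g : smooth f -> smooth g -> smooth (fun x => f x * g x).

Lemma smooth_derive f : smooth f ->
  exists2 g, smooth g & forall x, is_derive x 1 f (g x).
Proof.
elim=> [P a b|c|f1 f2 sf1 [g1 sg1 h1] sf2 [g2 sg2 h2]|
  f1 f2 sf1 [g1 sg1 h1] sf2 [g2 sg2 h2]].
- exists (fun x => flat ('X^2 * (P - P^`())) (a * x + b) * a).
    apply: smooth_mul; [exact: smooth_flat|exact: smooth_cst].
  move=> x.
  have dl : is_derive x 1 (fun x : R => a * x + b) a.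
    apply: (is_derive_eq (is_deriveD (is_deriveZ a (@is_derive_id _ _ x (1:R)))
      (@is_derive_cst _ _ _ b x 1))).
    by rewrite addr0 /GRing.scale/= mulr1.
  by apply: (is_derive_eq (@is_derive1_comp R (flat P) (fun x => a * x + b) x _ _
    (is_derive_flat P _) dl)).
- by exists (cst 0); [exact: smooth_cst|move=> x; exact: is_derive_cst].
- exists (fun x => g1 x + g2 x); first exact: smooth_add.
  by move=> x; exact: is_deriveD.
- exists (fun x => f1 x * g2 x + f2 x * g1 x).
    by apply: smooth_add; exact: smooth_mul.
  by move=> x; exact: is_deriveM.
Qed.

Lemma smooth_derivable f x : smooth f -> derivable f x 1.
Proof. by move=> /smooth_derive[g _ /(_ x)[]]. Qed.

Lemma smooth_continuous f : smooth f -> continuous f.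
Proof.
by move=> sf x; apply/differentiable_continuous/derivable1_diffP/smooth_derivable.
Qed.

Lemma smooth_derive1n f n : smooth f -> smooth (derive1n n f).
Proof.
elim: n f => // n ih f sf; rewrite derive1Sn; apply: ih.
have [g sg fg] := smooth_derive sf.
suff -> : derive1 f = g by [].
by apply/funext => x; rewrite derive1E; case: (fg x).
Qed.

(** The parameter k is a steepness: for k > 0 the support is [a, b] whatever k is, and since
    [flat 1 (k * y)] is exp(-1/(k y)) for y > 0, the bumps tend to the indicator of ]a, b[ as k
    grows. *)
Definition bump a b k x := flat 1 (k * (x - a)) * flat 1 (k * (b - x)).

Lemma smooth_bump a b k : smooth (bump a b k).
Proof.
rewrite (_ : bump a b k =
    fun x => flat 1 (k * x + - (k * a)) * flat 1 (- k * x + k * b)).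
  by apply: smooth_mul; exact: smooth_flat.
by apply/funext => x; rewrite /bump; congr (flat _ _ * flat _ _); ring.
Qed.

Lemma continuous_bump a b k : continuous (bump a b k).
Proof. exact: smooth_continuous (smooth_bump a b k). Qed.

Lemma flat1_ge0 x : 0 <= flat 1 x.
Proof. by rewrite /flat; case: ifP => // _; rewrite hornerC mul1r expR_ge0. Qed.

Lemma flat1_le1 x : flat 1 x <= 1.
Proof.
rewrite /flat; case: ifPn => // x0.
by rewrite hornerC mul1r expR_le1 oppr_le0 invr_ge0 ltW.
Qed.

Lemma bump_ge0 a b k x : 0 <= bump a b k x.
Proof. by rewrite mulr_ge0// flat1_ge0. Qed.

Lemma bump_le1 a b k x : bump a b k x <= 1.
Proof. by rewrite mulr_ile1// ?flat1_ge0// flat1_le1. Qed.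

Lemma bump_out a b k x : 0 <= k -> ~~ (a < x < b) -> bump a b k x = 0.
Proof.
rewrite /bump => k0; rewrite negb_and -!leNgt => /orP[xa|bx].
  by rewrite flat_le0 ?mul0r// mulr_ge0_le0// subr_le0.
by rewrite [X in _ * X]flat_le0 ?mulr0// mulr_ge0_le0// subr_le0.
Qed.

Lemma bump_gt0 a b k x : 0 < k -> a < x < b -> 0 < bump a b k x.
Proof.
move=> k0 /andP[ax xb].
have flat1_gt0 y : 0 < y -> 0 < flat 1 y.
  by rewrite /flat => ->; rewrite hornerC mul1r expR_gt0.
by apply: mulr_gt0; apply: flat1_gt0; rewrite mulr_gt0// subr_gt0.
Qed.

Lemma cvg_flat1 x : 0 < x -> flat 1 (n.+1%:R * x) @[n --> \oo] --> (1 : R).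
Proof.
move=> x0; rewrite -[X in _ --> X]expR0.
have -> : (fun n => flat 1 (n.+1%:R * x)) =
    (fun n => expR (- (x^-1 * (harmonic n)))).
  apply/funext => n; rewrite /flat ifT ?mulr_gt0//.
  by rewrite hornerC mul1r invfM mulrC.
apply: continuous_cvg; first exact: continuous_expR.
rewrite -[X in _ --> X]oppr0; apply: cvgN.
rewrite -[X in _ --> X](mulr0 x^-1); apply: cvgMr.
exact: cvg_harmonic.
Qed.

Lemma cvg_bump a b x :
  bump a b n.+1%:R x @[n --> \oo] --> (\1_`]a, b[%classic x : R).
Proof.
have [xab|xab] := boolP (a < x < b).
  rewrite indicE mem_set/= ?in_itv//= -[X in _ --> X]mulr1.
  by move: xab => /andP[ax xb]; apply: cvgM; apply: cvg_flat1; rewrite subr_gt0.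
rewrite indicE memNset/=; last by rewrite in_itv/=; exact/negP.
rewrite (_ : (fun n => _) = cst 0); first exact: cvg_cst.
by apply/funext => n; rewrite bump_out.
Qed.

End Smooth.

(** * Test functions and their membership in W_0^{1,p} *)

Section TestFunctions.
Context {R : realType}.
Implicit Types (f g u v phi psi : R -> R) (p a b c x y : R).
Local Notation mu := (@lebesgue_measure R).

Lemma integrable_oo_cc a b f : mu.-integrable `]a, b[ (EFin \o f) ->
  mu.-integrable `[a, b] (EFin \o f).
Proof.
move=> /integrableP[mf foo]; apply/integrableP; split.
  by move/measurable_EFinP : mf => /measurable_fun_itv_cc/measurable_EFinP.
by rewrite integral_itv_bndoo//; exact: measurableT_comp.
Qed.

Lemma Rintegral_oo_cc a b f : measurable_fun `]a, b[ f ->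
  \int[mu]_(x in `]a, b[) f x = \int[mu]_(x in `[a, b]) f x.
Proof.
by move=> mf; rewrite /Rintegral [in RHS]integral_itv_bndoo//; exact/measurable_EFinP.
Qed.

Lemma measurable_fun_continuous (D : set R) f : continuous f -> measurable_fun D f.
Proof. by move=> cf; apply: measurable_funTS; exact: continuous_measurable_fun. Qed.

Lemma integrable_continuous_within a b f : {within `[a, b], continuous f} ->
  mu.-integrable `[a, b] (EFin \o f).
Proof. by move=> cf; apply: continuous_compact_integrable => //; exact: segment_compact. Qed.

Lemma integrable_continuous a b f : continuous f ->
  mu.-integrable `[a, b] (EFin \o f).
Proof. by move=> cf; apply/integrable_continuous_within/continuous_subspaceT. Qed.

Lemma integrableD_EFin (D : set R) f g : measurable D ->
  mu.-integrable D (EFin \o f) -> mu.-integrable D (EFin \o g) ->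
  mu.-integrable D (EFin \o (fun x => f x + g x)).
Proof.
move=> mD fi gi.
have -> : EFin \o (fun x => f x + g x) = ((EFin \o f) \+ (EFin \o g))%E.
  by apply/funext => x /=; rewrite EFinD.
exact: integrableD.
Qed.

Lemma integrableB_EFin (D : set R) f g : measurable D ->
  mu.-integrable D (EFin \o f) -> mu.-integrable D (EFin \o g) ->
  mu.-integrable D (EFin \o (fun x => f x - g x)).
Proof.
move=> mD fi gi.
have -> : EFin \o (fun x => f x - g x) = ((EFin \o f) \- (EFin \o g))%E.
  by apply/funext => x /=; rewrite EFinB.
exact: integrableB.
Qed.

Lemma integrableZ_EFin (D : set R) c f : measurable D ->
  mu.-integrable D (EFin \o f) -> mu.-integrable D (EFin \o (fun x => c * f x)).
Proof.
move=> mD fi.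
have -> : EFin \o (fun x => c * f x) = (fun x => c%:E * (EFin \o f) x)%E.
  by apply/funext => x /=; rewrite EFinM.
exact: integrableZl.
Qed.

Lemma integrableM_bounded (D : set R) f g (M : R) : measurable D ->
  mu.-integrable D (EFin \o f) -> measurable_fun D g ->
  (forall x, D x -> `|g x| <= M) ->
  mu.-integrable D (EFin \o (fun x => f x * g x)).
Proof.
move=> mD fi mg gM.
have -> : EFin \o (fun x => f x * g x) = ((EFin \o f) \* (EFin \o g))%E.
  by apply/funext => x /=; rewrite EFinM.
apply: integrableMl => //; exists M; split; first exact: num_real.
by move=> y My x Dx /=; rewrite (le_trans (gM x Dx))// ltW.
Qed.

Lemma Rintegral_itv_cat a b c f : a <= b -> b <= c ->
  mu.-integrable `[a, c] (EFin \o f) ->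
  \int[mu]_(x in `[a, c]) f x =
  \int[mu]_(x in `[a, b]) f x + \int[mu]_(x in `[b, c]) f x.
Proof.
move=> ab bc fi.
have ibc : mu.-integrable `]b, c] (EFin \o f).
  by apply: integrableS fi => //; apply: subset_itv; rewrite bnd_simp.
have := @Rintegral_itvB _ f (BLeft a) (BRight c) b fi ab bc.
by rewrite (Rintegral_itv_obnd_cbnd ibc) => <-; rewrite addrC subrK.
Qed.

Lemma continuous_bounded_itv a b f : continuous f ->
  exists2 M, 0 < M & forall x, a <= x <= b -> `|f x| <= M.
Proof.
move=> cf.
have /compact_bounded[M [_ Mf]] := continuous_compact
  (continuous_subspaceT (A := `[a, b]%classic) cf) (@segment_compact _ a b).
exists (`|M| + 1); first by rewrite ltr_wpDl.
move=> x xab; apply: (Mf (`|M| + 1)) => /=.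
  by rewrite (le_lt_trans (ler_norm M))// ltrDl.
by exists x.
Qed.

Lemma measurable_Omega : measurable (@Omega R).
Proof. exact: measurable_itv. Qed.

(** The zero mean of [psi] makes its primitive vanish again to the right of b, so the primitive is
    compactly supported. This realises every such [psi] as the derivative of a test function. *)
Lemma primitive_test psi a b : smooth psi -> -1 < a -> a <= b -> b < 1 ->
  (forall x, ~~ (a < x < b) -> psi x = 0) ->
  \int[mu]_(x in `[-1, 1]) psi x = 0 ->
  let phi x := \int[mu]_(t in `[-1, x]) psi t in
  test_function phi /\ derive1 phi = psi.
Proof.
move=> spsi a1 ab b1 psi0 int0 phi.
have cpsi := smooth_continuous spsi.
have phil x : x <= a -> phi x = 0.
  move=> xa; rewrite /phi; under eq_Rintegral => t.
    rewrite inE/= in_itv/= => /andP[_ tx].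
    rewrite psi0; last by rewrite negb_and -!leNgt (le_trans tx).
    over.
  by rewrite Rintegral_cst// mul0r.
have phir x : b <= x -> phi x = 0.
  move=> bx; have zr y : b <= y -> phi y = phi b.
    move=> yb; rewrite /phi (@Rintegral_itv_cat _ b)//; last 2 first.
      by rewrite (le_trans _ ab)// ltW.
      exact: integrable_continuous.
    under [X in _ + X]eq_Rintegral => t.
      rewrite inE/= in_itv/= => /andP[bt _].
      rewrite psi0; last by rewrite negb_and -!leNgt bt orbT.
      over.
    by rewrite Rintegral_cst// mul0r addr0.
  by rewrite zr// -(zr 1) ?ltW.
have dphi x : is_derive x 1 phi (psi x).
  (* Differentiating the integral at x requires -1 < x; left of a the primitive is locally zero
     instead. *)
  have [xa|ax] := ltP x a.
    rewrite psi0; last by rewrite negb_and -!leNgt ltW.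
    apply: (@near_eq_is_derive _ _ _ (cst 0)) => //.
    near=> y; rewrite phil//; near: y; exact: lt_le_nbhsl.
  have [] := @continuous_FTC1_closed _ psi (-1) x (x + 1) _ _ _ (cpsi x).
  - by rewrite ltrDl.
  - exact: integrable_continuous.
  - exact: lt_le_trans ax.
  by move=> d1 d2; apply: DeriveDef; [exact: d1|rewrite -derive1E].
have dphiE : derive1 phi = psi.
  by apply/funext => x; rewrite derive1E; case: (dphi x).
split=> //; split.
  case=> [|n] x; first by case: (dphi x).
  by rewrite derive1Sn dphiE; apply/smooth_derivable/smooth_derive1n.
exists `[a, b]%classic; first split.
- exact: segment_compact.
- by apply: subset_itv; rewrite bnd_simp.
move=> x /= /negP; rewrite in_itv/= negb_and -!ltNge => /orP[/ltW|/ltW].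
  exact: phil.
exact: phir.
Unshelve. all: by end_near. Qed.

Lemma test_continuous phi : test_function phi ->
  continuous phi /\ continuous (derive1 phi).
Proof.
move=> [d _]; split=> x; apply/differentiable_continuous/derivable1_diffP.
  exact: (d 0%N).
exact: (d 1%N).
Qed.

Lemma test_is_derive phi x : test_function phi -> is_derive x 1 phi (derive1 phi x).
Proof. by move=> [/(_ 0%N x) d _]; apply: DeriveDef => //; rewrite derive1E. Qed.

Lemma test_ends phi : test_function phi -> phi (-1) = 0 /\ phi 1 = 0.
Proof.
move=> [_ [K [_ KO] K0]]; split; apply: K0 => /KO; rewrite /Omega/= in_itv/= ltxx//.
by rewrite andbF.
Qed.

Lemma test_FTC phi x y : test_function phi -> x <= y ->
  \int[mu]_(t in `[x, y]) derive1 phi t = phi y - phi x.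
Proof.
move=> tphi; rewrite le_eqVlt => /predU1P[->|xy].
  by rewrite set_itv1 Rintegral_set1 subrr.
have [cphi cphi'] := test_continuous tphi.
rewrite /Rintegral (@continuous_FTC2 _ _ phi)//.
- exact: continuous_subspaceT.
- split=> [z _|//|//]; first by case: (test_is_derive z tphi).
  + exact/cvg_at_right_filter/cphi.
  + exact/cvg_at_left_filter/cphi.
Qed.

Lemma Lp_bounded p f (M : R) : 0 < p -> measurable_fun (@Omega R) f ->
  (forall x, Omega x -> `|f x| <= M) -> Lp p f.
Proof.
move=> p0 mf fM; rewrite /Lp inE; apply/andP; split; rewrite inE/=.
  by apply: (measurable_restrictT _ _).1 => //; exact: measurable_Omega.
rewrite /finite_norm unlock poweR_lty//.
have iM : mu.-integrable (@Omega R) (cst (M `^ p)%:E).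
  apply: measurable_bounded_integrable; [exact: measurable_Omega| |exact: measurable_cst|].
    by rewrite /Omega/= lebesgue_measure_itv/=; case: ifP; rewrite ltry.
  exact: bounded_cst.
have -> : (fun x => `|(EFin \o f \_ Omega) x| `^ p)%E =
          (fun x => (`|f x| `^ p)%:E) \_ Omega.
  apply/funext => x; rewrite /= !patchE; case: ifPn => // _.
  by rewrite normr0 powR0// gt_eqF.
rewrite -integral_mkcond.
apply: (@le_lt_trans _ _ (\int[mu]_(x in Omega) (cst (M `^ p)%:E) x)%E).
  apply: ge0_le_integral => //=.
  - exact: measurable_Omega.
  - apply/measurable_EFinP; apply: (measurableT_comp (measurable_powR p)).
    exact: measurableT_comp.
  - move=> x Ox; rewrite lee_fin ge0_ler_powR ?nnegrE ?(ltW p0)//.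
      by rewrite (le_trans _ (fM _ Ox)).
    exact: fM.
by apply: integrable_lty iM; exact: measurable_Omega.
Qed.

Lemma test_absolutely_continuous phi : test_function phi ->
  absolutely_continuous (-1) 1 phi.
Proof.
move=> tphi e e0; have [cphi cphi'] := test_continuous tphi.
have [M M0 phiM] := continuous_bounded_itv (-1) 1 cphi'.
exists (e / M); first by rewrite divr_gt0.
move=> n s t st _ ste.
apply: (@le_lt_trans _ _ (\sum_(i < n) M * (t i - s i))); last first.
  by rewrite -mulr_sumr mulrC -ltr_pdivlMr.
apply: ler_sum => i _; have [s1 sti t1] := st i.
have [z] := MVT_segment sti (fun x _ => test_is_derive x tphi) (continuous_subspaceT cphi).
rewrite in_itv/= => /andP[sz zt] ->; rewrite normrM [X in _ * X]ger0_norm ?subr_ge0//.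
rewrite ler_wpM2r ?subr_ge0// phiM// (le_trans s1 sz)/=.
exact: le_trans t1.
Qed.

Lemma test_weak_derivative phi : test_function phi ->
  weak_derivative phi (derive1 phi).
Proof.
move=> tphi psi tpsi; have [cphi cphi'] := test_continuous tphi.
have [cpsi cpsi'] := test_continuous tpsi.
have cdr g : test_function g -> derivable_oo_LRcontinuous g (-1) 1.
  move=> tg; have [cg _] := test_continuous tg; split.
  - by move=> z _; case: (test_is_derive z tg).
  - exact/cvg_at_right_filter/cg.
  - exact/cvg_at_left_filter/cg.
rewrite !Rintegral_oo_cc; last 2 first.
- by apply: measurable_fun_continuous => x; apply: cvgM; [exact: cphi'|exact: cpsi].
- by apply: measurable_fun_continuous => x; apply: cvgM; [exact: cphi|exact: cpsi'].
rewrite (@Rintegration_by_parts _ phi psi (derive1 phi))//.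
- by rewrite (test_ends tphi).1 (test_ends tphi).2 !mul0r subrr sub0r.
- exact: continuous_subspaceT.
- exact: cdr.
- exact: continuous_subspaceT.
- exact: cdr.
Qed.

Lemma test_W01p p phi : 1 < p -> test_function phi -> W01p p phi (derive1 phi).
Proof.
move=> p1 tphi; have [cphi cphi'] := test_continuous tphi.
have p0 : 0 < p by rewrite (lt_trans _ p1).
have Lpc g : continuous g -> Lp p g.
  move=> cg; have [M M0 gM] := continuous_bounded_itv (-1) 1 cg.
  apply: (@Lp_bounded _ _ M) => //; first exact: measurable_fun_continuous.
  move=> x; rewrite /Omega/= in_itv/= => /andP[/ltW x1 /ltW x2].
  by apply: gM; rewrite x1.
split; first exact: test_absolutely_continuous.
- by split; [exact: Lpc|exact: Lpc|exact: test_weak_derivative].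
- exists (fun=> phi); split => //.
  + apply: cvg_near_cst; apply: nearW => _; rewrite /Lp_norm.
    rewrite (_ : EFin \o _ = cst 0%E) ?Lnorm0//; first by rewrite eqe gt_eqF.
    by apply/funext => x /=; rewrite patchE subrr; case: ifP.
  + apply: cvg_near_cst; apply: nearW => _; rewrite /Lp_norm.
    rewrite (_ : EFin \o _ = cst 0%E) ?Lnorm0//; first by rewrite eqe gt_eqF.
    by apply/funext => x /=; rewrite patchE subrr; case: ifP.
Qed.

End TestFunctions.

(** * Functions of W_0^{1,p} as primitives of their weak derivatives *)

Section Representation.
Context {R : realType}.
Implicit Types (f g u du phi : R -> R) (p a b c x y : R).
Local Notation mu := (@lebesgue_measure R).

Lemma ae_exists_itv a b (P : R -> Prop) : a < b -> {ae mu, forall x, P x} ->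
  exists2 x, a < x < b & P x.
Proof.
move=> ab [N [mN N0 NP]]; apply: contrapT => noP.
have : (mu `]a, b[%classic <= mu N)%E.
  apply: le_measure; rewrite ?inE// => x /=; rewrite in_itv/= => xab.
  by apply: NP => Px; apply: noP; exists x.
by rewrite N0 /= lebesgue_measure_itv/= lte_fin ab lee_fin leNgt subr_gt0 ab.
Qed.

(** If f and g differ at x, they differ on a relative neighbourhood of x, which has positive
    measure. *)
Lemma continuous_ae_eq a b f g : a < b ->
  {within `[a, b], continuous f} -> {within `[a, b], continuous g} ->
  {ae mu, forall x, x \in `[a, b] -> f x = g x} ->
  forall x, x \in `[a, b] -> f x = g x.
Proof.
move=> ab cf cg fg x xab; apply/eqP; rewrite -subr_eq0; apply: contrapT => /negP dx0.
have cd : {within `[a, b], continuous (fun y => f y - g y)}.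
  by move=> y; apply: cvgB; [exact: cf|exact: cg].
move/subspace_continuousP : cd => /(_ x xab) /cvgrPdist_lt/(_ `|f x - g x|).
rewrite normr_gt0 => /(_ dx0); rewrite near_withinE => -[r /= r0 hr].
have xab' := xab; move: xab; rewrite in_itv/= => /andP[ax xb].
(* Clipping to [a, b] leaves a nonempty open interval even when x is an endpoint. *)
pose c := Num.max a (x - r); pose d := Num.min b (x + r).
have cd : c < d.
  rewrite /c /d gt_max !lt_min ab !ltrBlDr -addrA !(@ltr_pwDr _ x) ?addr_gt0//.
  by rewrite (le_lt_trans ax) ?ltrDl// (le_lt_trans xb) ?ltrDl.
have [y /andP[cy yd] fgy] := ae_exists_itv cd fg.
move: cy yd; rewrite /c /d gt_max lt_min => /andP[ay xry] /andP[yb yxr].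
have yab : y \in `[a, b] by rewrite in_itv/= !ltW.
have := hr y; rewrite /ball_/= ltr_distlC xry yxr => /(_ isT yab).
by rewrite /from_subspace fgy// subrr subr0 ltxx.
Qed.

Lemma Rintegral_norm_eq0 a b f : a < b -> {within `[a, b], continuous f} ->
  \int[mu]_(x in `[a, b]) `|f x| = 0 -> forall x, x \in `[a, b] -> f x = 0.
Proof.
move=> ab cf int0; have fi := integrable_continuous_within cf.
apply: (@continuous_ae_eq _ _ _ (cst 0)) => //.
  by apply: continuous_subspaceT; exact: cst_continuous.
have : ae_eq mu `[a, b]%classic (EFin \o f) (cst 0%E).
  apply/ae_eq_integral_abs => //; first exact: (measurable_int mu).
  rewrite -[LHS]fineK ?int0; last first.
    by apply: integrable_fin_num => //; exact: integrable_abse.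
  exact: (congr1 EFin int0).
by apply: filterS => y h yI; have := h yI => -[->].
Qed.

Lemma absolutely_continuous_within a b u : absolutely_continuous a b u ->
  {within `[a, b], continuous u}.
Proof.
move=> acu; apply/subspace_continuousP => x; rewrite /= in_itv/= => /andP[ax xb].
apply/cvgrPdist_lt => e e0; have [d d0 h] := acu e e0.
rewrite near_withinE; near=> y; rewrite /= in_itv/= => /andP[ay yb].
have xyd : `|x - y| < d.
  by near: y; apply: (@cvgr_dist_lt _ _ _ _ _ id) => //.
have key s t : a <= s -> s <= t -> t <= b -> t - s < d -> `|u t - u s| < e.
  move=> as_ st tb std.
  have := h 1%N (fun=> s) (fun=> t); rewrite !big_ord1; apply => //.
  by apply/trivIsetP => i j _ _; rewrite !ord1 eqxx.
have [xy|/ltW yx] := leP x y.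
  by rewrite distrC key// -(ger0_norm (_ : 0 <= y - x)) ?subr_ge0// distrC.
by rewrite key// -(ger0_norm (_ : 0 <= x - y)) ?subr_ge0.
Unshelve. all: by end_near. Qed.

(** Hölder against the constant 1: C is the L^q norm of 1 on the bounded interval, q being the
    conjugate exponent. It turns convergence in W^{1,p} into L^1 convergence of functions and
    derivatives. *)
Lemma L1_le_Lp_norm p : 1 < p -> exists2 C : R, 0 <= C &
  forall g, measurable_fun (@Omega R) g ->
    (\int[mu]_(x in Omega) `|(g x)%:E| <= Lp_norm p g * C%:E)%E.
Proof.
move=> p1; have p0 : 0 < p by rewrite (lt_trans _ p1).
pose q := (1 - p^-1)^-1.
have q0 : 0 < q by rewrite invr_gt0 subr_gt0 invf_lt1.
have : Lp q (cst 1 : R -> R) by apply: (@Lp_bounded _ _ _ 1) => // x _; rewrite normr1.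
rewrite /Lp inE => /andP[/[!inE]/= mc]; rewrite /finite_norm => cfin.
have Cfin : Lp_norm q (cst 1 : R -> R) \is a fin_num.
  by rewrite ge0_fin_numE// Lnorm_ge0.
exists (fine (Lp_norm q (cst 1 : R -> R))).
  by rewrite fine_ge0// Lnorm_ge0.
move=> g mg; rewrite fineK//.
have mg' : measurable_fun setT (g \_ (@Omega R)).
  by apply: (measurable_restrictT _ _).1 => //; exact: measurable_Omega.
apply: le_trans (@hoelder _ _ _ mu _ _ p q mg' mc p0 q0 _); last first.
  by rewrite /q invrK addrC subrK.
rewrite Lnorm1 [leLHS]integral_mkcond le_eqVlt; apply/orP; left; apply/eqP.
apply: eq_integral => x _; rewrite /= !patchE; case: ifP => _.
  by rewrite mulr1.
by rewrite mul0r normr0.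
Qed.

Lemma Lp_cvg_L1 p (g : nat -> R -> R) (e : R) : 1 < p -> 0 < e ->
  (forall n, measurable_fun (@Omega R) (g n)) ->
  Lp_norm p (g n) @[n --> \oo] --> 0%E ->
  \forall n \near \oo, (\int[mu]_(x in Omega) `|(g n x)%:E| < e%:E)%E.
Proof.
move=> p1 e0 mg gp; have [C C0 hC] := L1_le_Lp_norm p1.
have gC : (Lp_norm p (g n) * C%:E)%E @[n --> \oo] --> 0%E.
  by rewrite -(mul0e C%:E); apply: cvgeZr.
near=> n; apply: le_lt_trans (hC _ (mg n)) _.
near: n; apply: (gC _ (open_ereal_lt' _)); rewrite lte_fin.
Unshelve. all: by end_near. Qed.
Lemma Lp_measurable p f : Lp p f -> measurable_fun (@Omega R) f.
Proof.
rewrite /Lp inE => /andP[/[!inE]/= mf _].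
by apply: (measurable_restrictT _ _).2 mf; exact: measurable_Omega.
Qed.

Lemma Lp_integrable p f : 1 < p -> Lp p f -> mu.-integrable (@Omega R) (EFin \o f).
Proof.
move=> p1 lf; have mf := Lp_measurable lf; apply/integrableP; split.
  exact/measurable_EFinP.
have [C C0 hC] := L1_le_Lp_norm p1.
apply: le_lt_trans (hC _ mf) _; move: lf.
rewrite /Lp inE => /andP[_ /[!inE]]; rewrite /= /finite_norm => flty.
have {}flty : Lp_norm p f \is a fin_num by rewrite ge0_fin_numE ?Lnorm_ge0.
by rewrite -(fineK flty) -EFinM ltry.
Qed.

Lemma le_Rintegral_itv a b c f : a <= b -> b <= c ->
  mu.-integrable `[a, c] (EFin \o f) -> (forall x, a <= x <= c -> 0 <= f x) ->
  \int[mu]_(x in `[a, b]) f x <= \int[mu]_(x in `[a, c]) f x.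
Proof.
move=> ab bc fi f0; rewrite (Rintegral_itv_cat ab bc)// lerDl.
apply: Rintegral_ge0 => x /=; rewrite in_itv/= => /andP[bx xc].
by rewrite f0// xc (le_trans ab).
Qed.

Lemma L1_small g (e : R) : measurable_fun (@Omega R) g ->
  (\int[mu]_(x in Omega) `|(g x)%:E| < e%:E)%E ->
  mu.-integrable `[-1, 1] (EFin \o g) /\ \int[mu]_(x in `[-1, 1]) `|g x| < e.
Proof.
move=> mg ge; have ig : mu.-integrable (@Omega R) (EFin \o g).
  apply/integrableP; split; first exact/measurable_EFinP.
  by rewrite (lt_trans ge)// ltry.
split; first exact: integrable_oo_cc.
rewrite -Rintegral_oo_cc; last exact: measurableT_comp.
rewrite -lte_fin /Rintegral fineK//.
rewrite ge0_fin_numE; last exact: integral_ge0.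
by rewrite (lt_trans ge)// ltry.
Qed.

Lemma one_itv : (1 : R) \in `[-1, 1].
Proof. by rewrite in_itv/= lexx andbT; lra. Qed.

(** Limit of phi_n(x) = \int_{-1}^x phi_n'. As phi_n' tends to [du] in L^1, phi_n tends uniformly to
    the primitive U of [du], while phi_n tends to u in L^1. Hence u = U almost everywhere, and
    everywhere by continuity; U(1) = 0 because phi_n(1) = 0. *)
Lemma W01p_primitive p u du : 1 < p -> W01p p u du ->
  [/\ mu.-integrable `[-1, 1] (EFin \o du), {within `[-1, 1], continuous u},
      u 1 = 0 &
      forall x, x \in `[-1, 1] -> u x = \int[mu]_(t in `[-1, x]) du t].
Proof.
move=> p1 [acu [Lu Ldu _] [phi [tphi phiu phidu]]].
have iu := integrable_oo_cc (Lp_integrable p1 Lu).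
have idu := integrable_oo_cc (Lp_integrable p1 Ldu).
have cu := absolutely_continuous_within acu.
pose U x := \int[mu]_(t in `[-1, x]) du t.
have cU : {within `[-1, 1], continuous U}.
  by apply: parameterized_integral_continuous => //; rewrite gtrN.
have approx e : 0 < e -> exists n,
    (\int[mu]_(t in `[-1, 1]) `|phi n t - u t| < e) /\
    forall x, x \in `[-1, 1] -> `|phi n x - U x| < e.
  move=> e0.
  have m1 n : measurable_fun (@Omega R) (fun x => phi n x - u x).
    apply: measurable_funB; last exact: Lp_measurable Lu.
    by apply: measurable_fun_continuous; case: (test_continuous (tphi n)).
  have m2 n : measurable_fun (@Omega R) (fun x => derive1 (phi n) x - du x).
    apply: measurable_funB; last exact: Lp_measurable Ldu.
    by apply: measurable_fun_continuous; case: (test_continuous (tphi n)).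
  have h1 := Lp_cvg_L1 p1 e0 m1 phiu; have h2 := Lp_cvg_L1 p1 e0 m2 phidu.
  have [n [h1n h2n]] := filter_ex (filterI h1 h2).
  exists n; split; first by have [] := L1_small (m1 n) h1n.
  have [i2 l2] := L1_small (m2 n) h2n.
  move=> x xI; move: (xI); rewrite in_itv/= => /andP[x1 x2].
  have sub : `[-1, x]%classic `<=` `[-1, 1]%classic.
    by apply: subset_itv; rewrite bnd_simp.
  rewrite -[phi n x]subr0 -(test_ends (tphi n)).1 -test_FTC// /U -RintegralB//; last 2 first.
  - by apply: integrable_continuous; case: (test_continuous (tphi n)).
  - exact: integrableS idu.
  apply: le_lt_trans l2; apply: le_trans (@le_Rintegral_itv _ x _ _ _ _ _ _) => //.
    by apply: le_normr_Rintegral => //; exact: integrableS i2.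
  exact: integrable_norm.
have U1 : U 1 = 0.
  apply/eqP; rewrite -normr_eq0 eq_le normr_ge0 andbT; apply/ler_addgt0Pl => e e0.
  rewrite addr0; have [n [_ /(_ 1)]] := approx _ e0.
  by rewrite (test_ends (tphi n)).2 sub0r normrN => /(_ one_itv)/ltW.
have cuU : {within `[-1, 1], continuous (fun x => u x - U x)}.
  by move=> x; apply: cvgB; [exact: cu|exact: cU].
have iuU : mu.-integrable `[-1, 1] (EFin \o (fun x => `|u x - U x|)).
  exact/integrable_norm/integrable_continuous_within.
have int0 : \int[mu]_(x in `[-1, 1]) `|u x - U x| = 0.
  apply/eqP; rewrite eq_le Rintegral_ge0// andbT; apply/ler_addgt0Pl => e e0.
  (* The interval has length 2: the uniform bound contributes 2e/3 and the L^1 distance e/3. *)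
  rewrite addr0; have e30 : 0 < e / 3 by rewrite divr_gt0.
  have [n [h1 h2]] := approx _ e30.
  have iphi : mu.-integrable `[-1, 1] (EFin \o (fun x => `|phi n x - u x|)).
    apply: integrable_norm.
    apply: integrableB_EFin => //.
    by apply: integrable_continuous; case: (test_continuous (tphi n)).
  apply: (@le_trans _ _ (\int[mu]_(x in `[-1, 1]) (`|phi n x - u x| + e / 3))).
    apply: le_Rintegral => //.
      apply: integrableD_EFin => //.
      apply: integrable_continuous; exact: cst_continuous.
    move=> x xI; have := h2 x xI; have := ler_distD (phi n x) (u x) (U x).
    by rewrite [`|u x - phi n x|]distrC => + /ltW; lra.
  rewrite RintegralD//; last by apply: integrable_continuous; exact: cst_continuous.
  rewrite Rintegral_cst//= lebesgue_measure_itv/= lte_fin ifT; [rewrite -EFinB/=; lra|lra].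
have uU x : x \in `[-1, 1] -> u x = U x.
  by move=> xI; apply/eqP; rewrite -subr_eq0; apply/eqP; exact: (Rintegral_norm_eq0 _ cuU).
split=> //.
by rewrite uU// one_itv.
Qed.

End Representation.

(** * Fubini on a triangle and integration by parts for integrable functions *)

Section DuBoisReymond.
Context {R : realType}.
Implicit Types (f g h phi : R -> R) (p a b c x y : R).
Local Notation mu := (@lebesgue_measure R).

(** Both sides integrate f(x) g(t) over the triangle a <= t <= x <= b; the product is integrable on
    the whole square, hence on the triangle. *)
Lemma Fubini_primitive a b f g :
  mu.-integrable `[a, b] (EFin \o f) -> mu.-integrable `[a, b] (EFin \o g) ->
  \int[mu]_(x in `[a, b]) (f x * \int[mu]_(t in `[a, x]) g t) =
  \int[mu]_(t in `[a, b]) (g t * \int[mu]_(x in `[t, b]) f x).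
Proof.
move=> fi gi.
pose fI := f \_ `[a, b]; pose gI := g \_ `[a, b].
have mI (k : R -> R) : mu.-integrable `[a, b] (EFin \o k) ->
    measurable_fun setT (k \_ `[a, b]).
  move=> /(measurable_int mu)/measurable_EFinP mk.
  exact/(measurable_restrictT _ _).1.
pose T := [set z : measurableTypeR R * measurableTypeR R | z.2 <= z.1].
pose k (z : measurableTypeR R * measurableTypeR R) := fI z.1 * gI z.2.
have mT : measurable T.
  by rewrite -[T]setTI; apply: measurable_fun_le.
have mk : measurable_fun setT k.
  by apply: measurable_funM; apply: measurableT_comp => //; exact: mI.
have mkT : measurable_fun setT (EFin \o (k \_ T)).
  by apply/measurable_EFinP/(measurable_restrictT _ _).1 => //; exact: measurable_funTS.
have iI (k' : R -> R) : mu.-integrable `[a, b] (EFin \o k') ->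
    mu.-integrable setT (EFin \o (k' \_ `[a, b])).
  by move=> ki; rewrite -restrict_EFin; apply/integrable_restrict => //; rewrite setTI.
have ifI := iI f fi; have igI := iI g gi.
have ik : (mu \x mu)%E.-integrable setT (EFin \o k).
  apply/integrable12ltyP => /=; first exact/measurable_EFinP.
  have gfin : (\int[mu]_t `|(gI t)%:E|)%E \is a fin_num.
    by apply: integrable_fin_num => //; exact: (integrable_abse igI).
  have ffin : (\int[mu]_t `|(fI t)%:E|)%E \is a fin_num.
    by apply: integrable_fin_num => //; exact: (integrable_abse ifI).
  have inner x : (\int[mu]_t (`|k (x, t)|%:E) = (\int[mu]_t `|(gI t)%:E|) * `|(fI x)%:E|)%E.
    rewrite muleC -ge0_integralZl//.
      by apply: eq_integral => t _; rewrite normrM EFinM.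
    by apply: measurableT_comp => //; exact: (measurable_int mu).
  under eq_integral do rewrite inner.
  rewrite ge0_integralZl//.
  - by rewrite -(fineK ffin) -(fineK gfin) -EFinM ltry.
  - by apply: measurableT_comp => //; exact: (measurable_int mu).
  - exact: integral_ge0.
have ikT : (mu \x mu)%E.-integrable setT (EFin \o (k \_ T)).
  apply: le_integrable ik => // z _ /=; rewrite patchE; case: ifP => _ //.
  by rewrite normr0 lee_fin.
have l x : (\int[mu]_t (EFin \o (k \_ T)) (x, t) =
    (((fun x => f x * \int[mu]_(t in `[a, x]) g t) \_ `[a, b]) x)%:E)%E.
  rewrite patchE; case: ifPn => xI.
    transitivity (\int[mu]_(t in `[a, x]) ((f x)%:E * (g t)%:E))%E.
      rewrite [RHS]integral_mkcond; apply: eq_integral => t _.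
      rewrite /= !patchE /k /fI /gI !patchE xI.
      move: xI; rewrite inE/= in_itv/= => /andP[ax xb].
      have [tx|xt] := leP t x.
        rewrite (mem_set (_ : T (x, t)))//; have [at_|ta] := leP a t.
          by rewrite !mem_set//= in_itv/= at_ ?tx// (le_trans tx).
        by rewrite !memNset ?mulr0//= in_itv/= leNgt ta.
      rewrite (memNset (_ : ~ T (x, t))); last by apply/negP; rewrite -ltNge.
      by rewrite memNset//= in_itv/= [t <= x]leNgt xt andbF.
    have ig : mu.-integrable `[a, x] (EFin \o g).
      move: xI; rewrite inE/= in_itv/= => /andP[ax xb].
      by apply: integrableS gi => //; apply: subset_itv; rewrite bnd_simp.
    by rewrite integralZl// EFinM fineK//; exact: integrable_fin_num.
  rewrite integral0_eq// => t _ /=; rewrite patchE /k /fI patchE (negbTE xI) mul0r.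
  by case: ifP.
have r t : (\int[mu]_x (EFin \o (k \_ T)) (x, t) =
    (((fun t => g t * \int[mu]_(x in `[t, b]) f x) \_ `[a, b]) t)%:E)%E.
  rewrite patchE; case: ifPn => tI.
    transitivity (\int[mu]_(x in `[t, b]) ((g t)%:E * (f x)%:E))%E.
      rewrite [RHS]integral_mkcond; apply: eq_integral => x _.
      rewrite /= !patchE /k /fI /gI !patchE tI.
      move: tI; rewrite inE/= in_itv/= => /andP[at_ tb].
      have [tx|xt] := leP t x.
        rewrite (mem_set (_ : T (x, t)))//; have [xb|bx] := leP x b.
          rewrite !mem_set//= ?in_itv/= ?xb ?tx ?(le_trans at_)//.
          by rewrite mulrC EFinM.
        rewrite !memNset ?mul0r//= in_itv/= [x <= b]leNgt bx andbF//.
      rewrite (memNset (_ : ~ T (x, t))); last by apply/negP; rewrite -ltNge.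
      by rewrite memNset//= in_itv/= [t <= x]leNgt xt.
    have if_ : mu.-integrable `[t, b] (EFin \o f).
      move: tI; rewrite inE/= in_itv/= => /andP[at_ tb].
      by apply: integrableS fi => //; apply: subset_itv; rewrite bnd_simp.
    by rewrite integralZl// EFinM fineK//; exact: integrable_fin_num.
  rewrite integral0_eq// => x _ /=; rewrite patchE /k /gI patchE (negbTE tI) mulr0.
  by case: ifP.
have := Fubini ikT => /=.
under eq_integral do rewrite l.
under [X in _ = X -> _]eq_integral do rewrite r.
by move=> h; rewrite Rintegral_mkcond [RHS]Rintegral_mkcond /Rintegral h.
Qed.

(** Since f is merely integrable, its primitive F need not be differentiable everywhere. So phi is
    written as the integral of phi' and the order of integration exchanged; the boundary term F(1)
    \int phi' vanishes. *)
Lemma test_by_parts f phi : mu.-integrable `[-1, 1] (EFin \o f) ->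
  test_function phi ->
  \int[mu]_(x in `[-1, 1]) (f x * phi x) =
  - \int[mu]_(x in `[-1, 1]) (\int[mu]_(t in `[-1, x]) f t * derive1 phi x).
Proof.
move=> fi tphi; have [cphi cphi'] := test_continuous tphi.
pose F x := \int[mu]_(t in `[-1, x]) f t.
have cF : {within `[-1, 1], continuous F}.
  by apply: parameterized_integral_continuous => //; lra.
have icp' := integrable_continuous (-1) 1 cphi'.
have iFp : mu.-integrable `[-1, 1] (EFin \o (fun x => F x * derive1 phi x)).
  apply: integrable_continuous_within => x; apply: cvgM; first exact: cF.
  exact: continuous_subspaceT.
transitivity (\int[mu]_(x in `[-1, 1]) (f x * \int[mu]_(t in `[-1, x]) derive1 phi t)).
  apply: eq_Rintegral => x; rewrite inE/= in_itv/= => /andP[x1 x2].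
  by rewrite test_FTC// (test_ends tphi).1 subr0.
rewrite Fubini_primitive//.
transitivity (\int[mu]_(x in `[-1, 1]) (F 1 * derive1 phi x - F x * derive1 phi x)).
  apply: eq_Rintegral => x; rewrite inE/= in_itv/= => /andP[x1 x2].
  by rewrite /F (Rintegral_itv_cat x1 x2)//; ring.
rewrite RintegralB//; last exact: integrableZ_EFin.
rewrite RintegralZl// test_FTC//.
by rewrite (test_ends tphi).1 (test_ends tphi).2 subrr mulr0 sub0r.
Qed.

End DuBoisReymond.

(** * The du Bois-Reymond lemma *)

Section WeaklyConstant.
Context {R : realType}.
Implicit Types (f g h phi : R -> R) (a b c k x y : R).
Local Notation mu := (@lebesgue_measure R).

(** A bump need not have zero mean, so its primitive need not be a test function. Subtracting a
    multiple of one fixed bump [rho] repairs this, and c is the mean of g weighted by [rho]. *)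
Lemma bump_orthogonal g : mu.-integrable `[-1, 1] (EFin \o g) ->
  (forall phi, test_function phi ->
    \int[mu]_(x in `[-1, 1]) (g x * derive1 phi x) = 0) ->
  exists c, forall a b k, -1 < a -> a <= b -> b < 1 -> 0 <= k ->
    \int[mu]_(x in `[-1, 1]) ((g x - c) * bump a b k x) = 0.
Proof.
move=> gi g0.
have ib a b k : mu.-integrable `[-1, 1] (EFin \o bump a b k).
  by apply: integrable_continuous; exact: continuous_bump.
have igb a b k : mu.-integrable `[-1, 1] (EFin \o (fun x => g x * bump a b k x)).
  apply: (@integrableM_bounded _ _ _ _ 1) => //.
    by apply: measurable_fun_continuous; exact: continuous_bump.
  by move=> x _; rewrite ger0_norm ?bump_ge0// bump_le1.
pose rho := @bump R (- 2^-1) 2^-1 1.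
pose Ir := \int[mu]_(x in `[-1, 1]) rho x.
have Ir0 : Ir != 0.
  apply/eqP => Ir0.
  have c0 : {within `[-1, 1], continuous rho}.
    by apply: continuous_subspaceT; exact: continuous_bump.
  have : rho 0 = 0.
    apply: (Rintegral_norm_eq0 _ c0) => //; last by rewrite in_itv/=; lra.
    by rewrite -[RHS]Ir0; apply: eq_Rintegral => x _; rewrite ger0_norm// bump_ge0.
  by apply/eqP; rewrite gt_eqF// bump_gt0//; lra.
exists (\int[mu]_(x in `[-1, 1]) (g x * rho x) / Ir).
move=> a b k a1 ab b1 k0.
pose s := \int[mu]_(x in `[-1, 1]) bump a b k x / Ir.
pose eta x := bump a b k x + (- s) * rho x.
have seta : smooth eta.
  apply: smooth_add; first exact: smooth_bump.
  by apply: (@smooth_mul _ (cst (- s))); [exact: smooth_cst|exact: smooth_bump].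
have eta0 : \int[mu]_(x in `[-1, 1]) eta x = 0.
  rewrite RintegralD//; last by apply: integrableZ_EFin => //; exact: ib.
  by rewrite RintegralZl//; [rewrite -/Ir /s mulNr divfK// subrr|exact: ib].
(* The smallest interval containing the supports of both bumps, still compactly inside ]-1, 1[. *)
have [||||tphi dphi] := @primitive_test R eta (Num.min a (- 2^-1)) (Num.max b 2^-1)
  seta _ _ _ _ eta0.
- by rewrite lt_min a1/=; lra.
- by rewrite ge_min !le_max ab.
- by rewrite gt_max b1/=; lra.
- move=> x; rewrite negb_and -!leNgt le_min ge_max => h.
  have [h1 h2] : ~~ (a < x < b) /\ ~~ (- 2^-1 < x < 2^-1).
    by rewrite !negb_and -!leNgt; case/orP : h => /andP[-> ->]; rewrite ?orbT.
  by rewrite /eta /rho (bump_out k0 h1) (bump_out ler01 h2) mulr0 addr0.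
have := g0 _ tphi; rewrite dphi /eta.
under eq_Rintegral => x _ do rewrite mulrDr (mulrCA (g x) (- s)).
rewrite RintegralD//; last by apply: integrableZ_EFin => //; exact: igb.
rewrite RintegralZl//; last exact: igb.
move=> gk.
under eq_Rintegral => x _ do rewrite mulrBl.
rewrite RintegralB//; last by apply: integrableZ_EFin => //; exact: ib.
by rewrite RintegralZl// -gk /s mulNr; congr (_ - _); rewrite [RHS]mulrAC mulrC mulrA.
Qed.

(** Dominated convergence: the bumps tend to the indicator of ]a, b[ and are bounded by 1, so |g|
    dominates. *)
Lemma bump_orthogonal_itv g a b : mu.-integrable `[-1, 1] (EFin \o g) ->
  -1 < a -> a <= b -> b < 1 ->
  (forall k, 0 <= k -> \int[mu]_(x in `[-1, 1]) (g x * bump a b k x) = 0) ->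
  \int[mu]_(x in `[a, b]) g x = 0.
Proof.
move=> gi a1 ab b1 gb.
have mg : measurable_fun `[(-1 : R), 1] g.
  by move: gi => /(measurable_int mu)/measurable_EFinP.
have mgb k : measurable_fun `[(-1 : R), 1] (fun x => g x * bump a b k x).
  apply: measurable_funM => //.
  by apply: measurable_fun_continuous; exact: continuous_bump.
have sub : `]a, b[%classic `<=` `[-1, 1]%classic.
  by apply: subset_itv; rewrite bnd_simp ltW.
have [||||| _ _ cv] := @dominated_convergence _ _ _ mu `[-1, 1]%classic (measurable_itv _)
  (fun n x => (g x * bump a b n.+1%:R x)%:E) (fun x => ((g \_ `]a, b[) x)%:E)
  (fun x => `|g x|%:E).
- by move=> n; apply/measurable_EFinP; exact: mgb.
- apply/measurable_EFinP/measurable_restrict => //.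
  by apply: measurable_funS mg => //; exact: subIsetr.
- apply: aeW => x xI; apply: cvg_EFin; first by apply: nearW.
  rewrite (_ : (g \_ `]a, b[) x = g x * \1_`]a, b[%classic x); last first.
    by rewrite patchE indicE; case: (_ \in _); rewrite ?mulr1 ?mulr0.
  by apply: cvgMr; exact: cvg_bump.
- exact: integrable_norm.
- apply: aeW => x n xI; rewrite /= lee_fin normrM ler_piMr//.
  by rewrite ger0_norm ?bump_ge0// bump_le1.
have z (n : nat) : (\int[mu]_(x in `[(-1)%R, 1%R]) (g x * bump a b n.+1%:R x)%:E)%E = 0%E.
  rewrite -[LHS]fineK ?[X in X%:E]gb//.
  apply: integrable_fin_num => //.
  apply: (@integrableM_bounded _ _ _ _ 1) => //.
    by apply: measurable_fun_continuous; exact: continuous_bump.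
  by move=> x _; rewrite ger0_norm ?bump_ge0// bump_le1.
move: cv; under eq_fun do rewrite z.
move=> /(cvg_unique _ (cvg_cst _))-/(_ (@ereal_hausdorff R)) e0.
rewrite -Rintegral_oo_cc; last by apply: measurable_funS mg.
by rewrite -(setIidr sub) Rintegral_mkcondr /Rintegral -e0.
Qed.

(** Lebesgue differentiation: the primitive of g is constant on ]-1, 1[, yet its derivative is g
    almost everywhere. *)
Lemma ae_eq0_itv g : mu.-integrable `[-1, 1] (EFin \o g) ->
  (forall a b, -1 < a -> a <= b -> b < 1 -> \int[mu]_(x in `[a, b]) g x = 0) ->
  {ae mu, forall x, -1 < x < 1 -> g x = 0}.
Proof.
move=> gi g0; pose d := g \_ `[-1, 1].
have mI : measurable (`[-1, 1]%classic : set R) by exact: measurable_itv.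
have di : mu.-integrable setT (EFin \o d).
  by rewrite /d -restrict_EFin; apply/integrable_restrict => //; rewrite setTI.
have diy y : mu.-integrable `[-1, y] (EFin \o d) by apply: integrableS di.
have := FTC1 (a := BLeft (-1)) diy (integrable_locally mI gi).
apply: filterS; first exact: (ae_filter_ringOfSetsType mu).
move=> x h /andP[x1 x2]; have [|_] := h; first by rewrite /= lte_fin.
rewrite /d patchE mem_set/= ?in_itv/= ?ltW// => <-.
pose F y := \int[mu]_(t in `[-1, y]) d t.
have dE c e : -1 < c -> c <= e -> e < 1 -> \int[mu]_(t in `[c, e]) d t = 0.
  move=> c1 ce e1; rewrite -[RHS](g0 c e)//; apply: eq_Rintegral => t.
  rewrite inE/= in_itv/= => /andP[ct te].
  by rewrite /d patchE mem_set//= in_itv/= (le_trans (ltW c1))// (le_trans te)// ltW.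
have FE y : -1 < y < 1 -> F y = F x.
  move=> /andP[y1 y2]; have [yx|/ltW xy] := leP y x.
    by rewrite /F (Rintegral_itv_cat (ltW y1) yx)// (dE y x)// addr0.
  by rewrite /F (Rintegral_itv_cat (ltW x1) xy)// (dE x y)// addr0.
have [_ F0] : is_derive x 1 F 0.
  apply: (@near_eq_is_derive _ _ _ (cst (F x))) => //.
  near=> y; symmetry; apply: FE; apply/andP; split.
    by near: y; exact: lt_nbhsr.
  by near: y; exact: lt_nbhsl.
by rewrite derive1E.
Unshelve. all: by end_near. Qed.

Lemma du_Bois_Reymond g : mu.-integrable `[-1, 1] (EFin \o g) ->
  (forall phi, test_function phi ->
    \int[mu]_(x in `[-1, 1]) (g x * derive1 phi x) = 0) ->
  exists c, {ae mu, forall x, -1 < x < 1 -> g x = c}.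
Proof.
move=> gi /(bump_orthogonal gi)[c gc]; exists c.
have gci : mu.-integrable `[-1, 1] (EFin \o (fun x => g x - c)).
  apply: integrableB_EFin => //; apply: integrable_continuous; exact: cst_continuous.
have h a b : -1 < a -> a <= b -> b < 1 -> \int[mu]_(x in `[a, b]) (g x - c) = 0.
  by move=> a1 ab b1; apply: bump_orthogonal_itv => // k k0; exact: gc.
have := ae_eq0_itv gci h.
apply: filterS; first exact: (ae_filter_ringOfSetsType mu).
by move=> x /[apply]/eqP; rewrite subr_eq0 => /eqP.
Qed.

End WeaklyConstant.

(** * Algebra and continuity of the power nonlinearity *)

Section Phi_lemmas.
Context {R : realType}.
Implicit Types (p q r x y z : R).

Lemma Phi_gt0E q z : 0 < z -> Phi q z = z `^ (q - 1).
Proof. by move=> z0; rewrite /Phi gtr0_norm// gtr0_sg// mulr1. Qed.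

Lemma Phi0 q : Phi q 0 = 0 :> R.
Proof. by rewrite /Phi sgr0 mulr0. Qed.

Lemma PhiN q z : Phi q (- z) = - Phi q z.
Proof. by rewrite /Phi normrN sgrN mulrN. Qed.

Lemma Phi_ge0 q z : 0 <= z -> 0 <= Phi q z.
Proof. by move=> z0; rewrite /Phi mulr_ge0 ?powR_ge0// sgr_ge0. Qed.

(** For p < 2 the factor |z|^(p-2) is singular near 0; the form [Phi p] is the one that is seen to
    be continuous and that [Phi q] inverts. *)
Lemma plapE p z : 1 < p -> plap p z = Phi p z.
Proof.
move=> p1; have pos y : 0 < y -> plap p y = Phi p y.
  move=> y0; rewrite Phi_gt0E// /plap gtr0_norm// mulrC.
  by rewrite -(mulr_powRB1 (ltW y0) (_ : 0 < p - 1)) ?subr_gt0//; congr (_ * _ `^ _); ring.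
have [z0|/pos//|->] := ltgtP z 0; last by rewrite Phi0 /plap mulr0.
rewrite -[z]opprK PhiN -pos ?oppr_gt0//.
by rewrite /plap !normrN mulrN.
Qed.

Lemma PhiM q x y : 0 < x -> Phi q (x * y) = x `^ (q - 1) * Phi q y.
Proof.
move=> x0; rewrite /Phi normrM sgrM (gtr0_sg x0) mul1r.
by rewrite (gtr0_norm x0) powRM ?(ltW x0)// mulrA.
Qed.

(** The hypothesis is the conjugacy 1/p + 1/q = 1 cleared of denominators; it makes the exponents p
    - 1 and q - 1 reciprocal. *)
Lemma PhiK p q z : (p - 1) * (q - 1) = 1 -> Phi q (Phi p z) = z.
Proof.
move=> pq; have pos y : 0 < y -> Phi q (Phi p y) = y.
  move=> y0; rewrite (Phi_gt0E p y0) Phi_gt0E ?powR_gt0//.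
  by rewrite -powRrM pq powRr1// ltW.
have [z0|/pos//|->] := ltgtP z 0; last by rewrite !Phi0.
by have := pos (- z); rewrite !PhiN oppr_gt0 => /(_ z0)/oppr_inj.
Qed.

Lemma continuous_Phi q : 1 < q -> continuous (@Phi R q).
Proof.
move=> q1; have pos y : 0 < y -> {for y, continuous (@Phi R q)}.
  move=> y0; have := is_derive1_powR (q - 1) y0.
  move=> [d _]; have c : {for y, continuous (fun x => x `^ (q - 1))}.
    exact/differentiable_continuous/derivable1_diffP.
  rewrite /prop_for /continuous_at Phi_gt0E//.
  apply: cvg_trans c; apply: near_eq_cvg; near=> x; rewrite Phi_gt0E//.
  by near: x; exact: lt_nbhsr.
move=> z; have [z0|/pos//|->] := ltgtP z 0.
- have /pos c : 0 < - z by rewrite oppr_gt0.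
  have -> : Phi q = (fun x => - Phi q (- x)) :> (R -> R).
    by apply/funext => x; rewrite PhiN opprK.
  apply: cvgN; apply: (@continuous_comp _ _ _ (@GRing.opp R) (Phi q)) => //.
  exact: opp_continuous.
- rewrite /continuous_at Phi0; apply/cvgr0Pnorm_lt => e e0.
  near=> x; have [->|x0] := eqVneq x 0; first by rewrite Phi0 normr0.
  rewrite /Phi normrM normr_sg x0 mulr1 ger0_norm ?powR_ge0//.
  (* This exhibits the radius e^(1/(q-1)) within which |x|^(q-1) < e. *)
  have -> : e = (e `^ (q - 1)^-1) `^ (q - 1).
    by rewrite -powRrM mulVf ?subr_eq0 ?gt_eqF// powRr1// ltW.
  rewrite gt0_ltr_powR ?subr_gt0 ?nnegrE ?powR_ge0//.
  near: x; apply: (cvgr0_norm_lt id) => //.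
  by rewrite powR_gt0.
Unshelve. all: by end_near. Qed.

Lemma Phi_le1 p z : 1 < p -> z <= 1 -> Phi p z <= 1.
Proof.
move=> p1 z1; have [z0|z0] := leP z 0.
  by rewrite (le_trans _ ler01)// -[z]opprK PhiN oppr_le0 Phi_ge0// oppr_ge0.
have h : z `^ (p - 1) <= 1 `^ (p - 1).
  by apply: ge0_ler_powR; rewrite ?nnegrE ?subr_ge0 //; exact: ltW.
by rewrite Phi_gt0E// (le_trans h)// powR1.
Qed.

End Phi_lemmas.

(** * Primitives: comparison almost everywhere and differentiation *)

Section Primitives.
Context {R : realType}.
Implicit Types (f g h k u : R -> R) (a b c x y : R).
Local Notation mu := (@lebesgue_measure R).

Lemma sub_ae (P Q : R -> Prop) : (forall x, P x -> Q x) ->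
  {ae mu, forall x, P x} -> {ae mu, forall x, Q x}.
Proof. by move=> PQ; apply: filterS; first exact: (ae_filter_ringOfSetsType mu). Qed.

Lemma ae_eq_Rintegral_itv a b f g :
  measurable_fun `]a, b[ f -> measurable_fun `]a, b[ g ->
  {ae mu, forall x, a < x < b -> f x = g x} ->
  \int[mu]_(x in `[a, b]) f x = \int[mu]_(x in `[a, b]) g x.
Proof.
move=> mf mg fg; rewrite -!Rintegral_oo_cc// /Rintegral; congr fine.
apply: ae_eq_integral => //; [exact/measurable_EFinP|exact/measurable_EFinP|].
by apply: sub_ae fg => x + /=; rewrite in_itv/= => /[apply] ->.
Qed.

Lemma Rintegral_ae_ge0 a b f : measurable_fun `]a, b[ f ->
  {ae mu, forall x, a < x < b -> 0 <= f x} -> 0 <= \int[mu]_(x in `[a, b]) f x.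
Proof.
move=> mf f0; rewrite (@ae_eq_Rintegral_itv _ _ _ (fun x => `|f x|))//.
- by apply: Rintegral_ge0.
- exact: measurableT_comp.
- by apply: sub_ae f0 => x /[apply] /ger0_norm ->.
Qed.

Lemma continuous_within_comp a b k h : continuous h ->
  {within `[a, b], continuous k} -> {within `[a, b], continuous (fun x => h (k x))}.
Proof. by move=> ch ck x; apply: (continuous_comp (ck x)); exact: ch. Qed.

(** The quotient is the mean of k between x and y, and continuity bounds its distance to k(x). The
    limit within [a, b] covers the one-sided quotients that [C1_on] asks for at the endpoints. *)
Lemma diff_quotient_primitive a b u k : {within `[a, b], continuous k} ->
  (forall x y, a <= x -> x <= y -> y <= b ->
    u y - u x = \int[mu]_(t in `[x, y]) k t) ->
  forall x, x \in `[a, b] ->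
    (u y - u x) / (y - x) @[y --> within `[a, b] (x^')] --> k x.
Proof.
move=> ck uk x; rewrite in_itv/= => /andP[ax xb].
have ik : mu.-integrable `[a, b] (EFin \o k) by exact: integrable_continuous_within.
apply/cvgrPdist_le => e e0.
move/subspace_continuousP : ck => /(_ x); rewrite /= in_itv/= ax xb => /(_ isT).
move=> /cvgrPdist_le/(_ e e0); rewrite near_withinE => -[r /= r0 hr].
(* Stated for any short interval near x, so that it serves both sides of x. *)
have key y z : a <= y -> y < z -> z <= b -> (forall t, y <= t <= z -> `|x - t| < r) ->
    `|k x - (u z - u y) / (z - y)| <= e.
  move=> ay yz zb yzr; have zy0 : 0 < z - y by rewrite subr_gt0.
  rewrite -(@ler_pM2r _ (z - y))// -[X in _ * X <= _](gtr0_norm zy0) -normrM.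
  rewrite mulrBl divfK ?gt_eqF//.
  have ikyz : mu.-integrable `[y, z] (EFin \o k).
    by apply: integrableS ik => //; apply: subset_itv; rewrite bnd_simp.
  have icyz (c : R) : mu.-integrable `[y, z] (EFin \o cst c).
    by apply: integrable_continuous; exact: cst_continuous.
  have iB : mu.-integrable `[y, z] (EFin \o (fun t => k x - k t)).
    by apply: integrableB_EFin => //; exact: icyz.
  have muyz : fine (mu `[y, z]%classic) = z - y.
    by rewrite /= lebesgue_measure_itv/= lte_fin yz.
  rewrite (uk y z ay (ltW yz) zb) -[X in k x * X]muyz -Rintegral_cst//.
  rewrite -RintegralB//; last exact: icyz.
  apply: (le_trans (le_normr_Rintegral _ _)) => //.
  rewrite -[X in e * X]muyz -Rintegral_cst//; apply: le_Rintegral => //.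
  - exact: integrable_norm.
  - exact: icyz.
  move=> t /=; rewrite in_itv/= => /andP[yt tz]; apply: hr.
    by rewrite /ball_/= yzr// yt.
  by rewrite in_itv/= (le_trans ay)// (le_trans tz).
rewrite near_withinE near_withinE; exists r => //= y; rewrite /ball_/= => xyr yx.
rewrite in_itv/= => /andP[ay yb].
have [yltx|xlty|/eqP] := ltgtP y x; last by rewrite (negbTE yx).
- rewrite -[y - x]opprB -[u y - u x]opprB invrN mulrNN.
  apply: key => // t /andP[yt tx]; apply: le_lt_trans xyr.
  by rewrite !ger0_norm ?subr_ge0// ?lerB// ltW.
- apply: key => // t /andP[xt ty]; apply: le_lt_trans xyr.
  by rewrite distrC [leRHS]distrC !ger0_norm ?subr_ge0// ?lerB// ltW.
Qed.

Lemma is_derive_primitive a b u k : {within `[a, b], continuous k} ->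
  (forall x y, a <= x -> x <= y -> y <= b ->
    u y - u x = \int[mu]_(t in `[x, y]) k t) ->
  forall x, a < x < b -> is_derive x 1 u (k x).
Proof.
move=> ck uk x /andP[ax xb].
have xab : x \in `[a, b] by rewrite in_itv/= !ltW.
have h := diff_quotient_primitive ck uk xab.
apply/is_derive1_caratheodory.
exists (fun z => if z == x then k x else (u z - u x) / (z - x)); split.
- move=> z; case: eqVneq => [->|zx]; first by rewrite !subrr mulr0.
  by rewrite divfK// subr_eq0.
- apply/continuous_withinNx; rewrite eqxx; apply/cvgrPdist_lt => e e0.
  move/cvgrPdist_lt : h => /(_ e e0); rewrite !near_withinE => h.
  near=> z => zx; rewrite (negbTE zx).
  have : z \in `[a, b].
    by rewrite in_itv/=; apply/andP; split; near: z; [exact: lt_le_nbhsr|exact: lt_le_nbhsl].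
  by move: zx; near: z.
- by rewrite eqxx.
Unshelve. all: by end_near. Qed.

End Primitives.

(** * Consequences of the flux equation: zeros of w and their exclusion *)

Section Flux.
Context {R : realType}.
Implicit Types (a b x y : R).
Local Notation mu := (@lebesgue_measure R).
Context (p q cs sn : R) (w du G : R -> R).
Context (p1 : 1 < p) (q1 : 1 < q) (pq : (p - 1) * (q - 1) = 1).
Context (cs0 : 0 < cs) (sn0 : 0 < sn) (sn1 : sn <= 1).
Context (idu : mu.-integrable `[-1, 1] (EFin \o du)).
Context (cw : {within `[-1, 1], continuous w}).
Context (cG : {within `[-1, 1], continuous G}).
Context (w_ge0 : forall x, x \in `[-1, 1] -> 0 <= w x).
Context (w_prim : forall x y, -1 <= x -> x <= y -> y <= 1 ->
  w y - w x = \int[mu]_(t in `[x, y]) du t).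
Context (flux : {ae mu, forall x, -1 < x < 1 ->
  w x * Phi p (du x * cs + sn) = G x}).

Let mdu a b : -1 <= a -> b <= 1 -> measurable_fun `]a, b[ du.
Proof.
move=> a1 b1; move: idu => /(measurable_int mu)/measurable_EFinP.
by apply: measurable_funS => //; apply: subset_itv; rewrite bnd_simp.
Qed.

Let near_I x (k : R -> R) (e : R) : -1 < x < 1 -> {within `[-1, 1], continuous k} ->
  0 < e -> exists2 r, 0 < r & forall y, x - r <= y <= x + r ->
    -1 < y < 1 /\ `|k x - k y| < e.
Proof.
move=> /andP[x1 x2] ck e0.
have xI : x \in `]-1, 1[ by rewrite in_itv/= x1.
have := within_continuous_continuous (lt_trans x1 x2) ck xI.
move=> /cvgrPdist_lt/(_ e e0) h.
have : \forall y \near x, -1 < y < 1 /\ `|k x - k y| < e.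
  near=> y; split; last by near: y.
  by apply/andP; split; near: y; [exact: lt_nbhsr|exact: lt_nbhsl].
move=> [r /= r0 hr]; exists (r / 2); first by rewrite divr_gt0.
move=> y xy; apply: hr => /=; rewrite ltr_distlC; lra.
Unshelve. all: by end_near. Qed.

(** The two signs are not symmetric. G < 0 gives z < 0, which already forces u' < 0; G > 0 gives
    only z > 0, which leaves the sign of u' open, so G must be compared with w, which is small near
    its zero. *)
Lemma flux_eq0 x : -1 < x < 1 -> w x = 0 -> G x = 0.
Proof.
move=> xI wx0; have [Gx|Gx|//] := ltgtP (G x) 0.
- have nGx : 0 < - G x by rewrite oppr_gt0.
  have [r r0 hr] := near_I xI cG nGx.
  have GN y : x < y < x + r -> [/\ -1 < y, y < 1 & G y < 0].
    move=> /andP[xy yr]; have [|/andP[y1 y2]] := hr y.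
      by apply/andP; split; lra.
    by rewrite ltr_distlC => /andP[_]; rewrite addrN.
  have x1 : -1 <= x by move: xI => /andP[/ltW].
  have xr1 : x + r <= 1.
    have [|/andP[_ /ltW]] // := hr (x + r).
    by apply/andP; split; lra.
  have du0 : {ae mu, forall y, x < y < x + r -> du y <= 0}.
    apply: sub_ae flux => y h /GN[y1 y2 Gy].
    have yI : -1 < y < 1 by rewrite y1.
    rewrite leNgt; apply/negP => duy.
    move: Gy; rewrite -h// ltNge => /negP; apply.
    rewrite mulr_ge0 ?Phi_ge0//.
      by apply: w_ge0; rewrite in_itv/= !ltW.
    by rewrite addr_ge0 ?ltW// mulr_gt0.
  (* Weak monotonicity suffices: w is nonnegative and cannot rise from its zero, so it vanishes
     here; the flux equation then gives G = 0 at some point, against the sign of G. *)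
  have w0 y : x < y < x + r -> w y = 0.
    move=> /andP[xy yr]; have y1 : y <= 1 by rewrite (le_trans _ xr1)// ltW.
    apply/eqP; rewrite eq_le w_ge0 ?andbT; last first.
      by rewrite in_itv/= y1 (le_trans x1)// ltW.
    have -> : w y = \int[mu]_(t in `[x, y]) du t.
      by rewrite -(w_prim x1 (ltW xy) y1) wx0 subr0.
    rewrite -oppr_ge0.
    rewrite -mulN1r -RintegralZl//; last first.
      by apply: integrableS idu => //; apply: subset_itv; rewrite bnd_simp.
    apply: Rintegral_ae_ge0.
      by apply: measurable_funM => //; exact: mdu.
    apply: sub_ae du0 => t h /andP[xt ty].
    by rewrite mulN1r oppr_ge0 h// xt (lt_trans ty).
  have [|y yr h] := @ae_exists_itv _ x (x + r) _ _ flux; first by rewrite ltrDl.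
  have [y1 y2 Gy] := GN y yr.
  by move: Gy; rewrite -h ?y1// w0// mul0r ltxx.
(* Half of [G x] bounds both oscillations, so that w(y) < G(x)/2 < G(y) near x. *)
- have Gx2 : 0 < G x / 2 by rewrite divr_gt0.
  have [r r0 hr] := near_I xI cG Gx2.
  have [s s0 hs] := near_I xI cw Gx2.
  pose d := Num.min r s.
  have d0 : 0 < d by rewrite lt_min r0.
  have GP y : x - d < y < x -> [/\ -1 < y, y < 1, w y < G y & 0 < G y].
    rewrite /d ltrBlDr addrC -ltrBlDr lt_min => /andP[/andP[yr ys] yx].
    have [|/andP[y1 y2]] := hr y; first by apply/andP; split; lra.
    rewrite ltr_distlC => /andP[Gy _].
    have [|_] := hs y; first by apply/andP; split; lra.
    by rewrite wx0 ltr_distlC => /andP[_ wy]; split => //; lra.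
  have x1 : x <= 1 by move: xI => /andP[_ /ltW].
  have dr : d <= r by rewrite /d ge_min lexx.
  have xd1 : -1 <= x - d.
    have [|/andP[/ltW]] // := hr (x - d).
    by apply/andP; split; lra.
  have du0 : {ae mu, forall y, x - d < y < x -> 0 <= du y}.
    apply: sub_ae flux => y h /GP[y1 y2 wG Gy].
    have yI : -1 < y < 1 by rewrite y1.
    rewrite leNgt; apply/negP => duy.
    move: wG; rewrite -h// ltNge => /negP; apply.
    rewrite ler_piMr//; first by apply: w_ge0; rewrite in_itv/= !ltW.
    rewrite Phi_le1// (le_trans _ sn1)// gerDr.
    by rewrite mulr_le0_ge0// ltW.
  have w0 y : x - d < y < x -> w y = 0.
    move=> /andP[dy yx]; have y1 : -1 <= y by rewrite (le_trans xd1)// ltW.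
    apply/eqP; rewrite eq_le w_ge0 ?andbT; last first.
      by rewrite in_itv/= y1 (le_trans _ x1)// ltW.
    have -> : w y = - \int[mu]_(t in `[y, x]) du t.
      by rewrite -(w_prim y1 (ltW yx) x1) wx0 sub0r opprK.
    rewrite oppr_le0; apply: Rintegral_ae_ge0; first exact: mdu.
    by apply: sub_ae du0 => t h /andP[yt tx]; rewrite h// tx (lt_trans dy).
  have [|y yr h] := @ae_exists_itv _ (x - d) x _ _ flux; first by rewrite ltrBlDr ltrDl.
  have [y1 y2 _ Gy] := GP y yr.
  by move: Gy; rewrite -h ?y1// w0// mul0r ltxx.
Qed.

(** The flux equation solved for u': a pointwise defined, continuous candidate to replace [du]. *)
Definition slope x := (Phi q (G x / w x) - sn) / cs.

Lemma slope_continuous a b : -1 <= a -> b <= 1 ->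
  (forall x, a <= x <= b -> 0 < w x) -> {within `[a, b], continuous slope}.
Proof.
move=> a1 b1 wpos; have sub : `[a, b]%classic `<=` `[-1, 1]%classic.
  by apply: subset_itv; rewrite bnd_simp.
have cwab := continuous_subspaceW sub cw; have cGab := continuous_subspaceW sub cG.
apply/subspace_continuousP => x xab.
move/subspace_continuousP : cwab => /(_ x xab) wx.
move/subspace_continuousP : cGab => /(_ x xab) Gx.
apply: cvgMl; apply: cvgB; last exact: cvg_cst.
apply: (@continuous_cvg _ _ _ _ _ _ (Phi q)); first exact: continuous_Phi.
apply: cvgM => //; apply: cvgV => //.
by rewrite gt_eqF// wpos//; move: xab; rewrite /= in_itv.
Qed.

(** [du] and [slope] agree almost everywhere where w > 0, so they have the same integrals. Here
    information almost everywhere becomes a continuous derivative. *)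
Lemma slope_primitive a b : -1 <= a -> b <= 1 ->
  (forall x, a <= x <= b -> 0 < w x) ->
  forall x y, a <= x -> x <= y -> y <= b ->
    w y - w x = \int[mu]_(t in `[x, y]) slope t.
Proof.
move=> a1 b1 wpos x y ax xy yb.
rewrite w_prim ?(le_trans a1 ax)// ?(le_trans yb)//.
apply: ae_eq_Rintegral_itv.
- by apply: mdu; [rewrite (le_trans a1)|rewrite (le_trans yb)].
- have : measurable_fun `[a, b] slope.
    by apply: subspace_continuous_measurable_fun => //; exact: slope_continuous.
  by apply: measurable_funS => //; apply: subset_itv; rewrite bnd_simp.
- apply: sub_ae flux => t h /andP[xt ty].
  have wt : 0 < w t by rewrite wpos// (le_trans ax (ltW xt)) (le_trans (ltW ty)).
  rewrite /slope -h; last first.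
    by rewrite (le_lt_trans a1)//= ?(lt_le_trans ty (le_trans yb b1))// (le_lt_trans ax).
  by rewrite mulrAC mulfV ?gt_eqF// mul1r PhiK// addrK mulfK// gt_eqF.
Qed.

(* Here q = p / (p - 1), so that [(w^q)' = q w^(q-1) w'] and the factor
   [w^(q-1)] absorbs the singularity of [slope] at the zero [s]. *)
Lemma flux_integrated s : -1 < s -> s < 1 -> w s = 0 ->
  (forall x, s < x <= 1 -> 0 < w x) ->
  w 1 `^ q <= q / cs * \int[mu]_(x in `[s, 1]) Phi q (G x).
Proof.
move=> s1 s2 ws0 wpos.
pose r x := q / cs * (Phi q (G x) - sn * Phi q (w x)).
(* V is w^q where w > 0, written through [Phi] to have continuity up to the zero s at hand. Its
   derivative [r] involves no division by w. *)
pose V x := Phi (q + 1) (w x).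
have q0 : 0 < q by rewrite (lt_trans _ q1).
have sub : `[s, 1]%classic `<=` `[-1, 1]%classic.
  by apply: subset_itv; rewrite bnd_simp// ltW.
have cws := continuous_subspaceW sub cw; have cGs := continuous_subspaceW sub cG.
have cPG : {within `[s, 1], continuous (fun x => Phi q (G x))}.
  by apply: continuous_within_comp => //; exact: continuous_Phi.
have cPw : {within `[s, 1], continuous (fun x => Phi q (w x))}.
  by apply: continuous_within_comp => //; exact: continuous_Phi.
have cr : {within `[s, 1], continuous r}.
  by move=> x; apply: cvgMr; apply: cvgB; [exact: cPG|apply: cvgMr; exact: cPw].
have cV : {within `[s, 1], continuous V}.
  by apply: continuous_within_comp => //; apply: continuous_Phi; rewrite ltrDr.
have dV x : x \in `]s, 1[ -> is_derive x 1 V (r x).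
  rewrite in_itv/= => /andP[sx x1].
  (* On [a, 1] w is positive, and x is interior to it, so [slope] can be used around x. *)
  pose a := (s + x) / 2.
  have wa y : a <= y <= 1 -> 0 < w y.
    by move=> /andP[ay y1]; rewrite wpos// y1 andbT; rewrite /a in ay; lra.
  have a1 : -1 <= a by rewrite /a; lra.
  have dw : is_derive x 1 w (slope x).
    apply: (is_derive_primitive (slope_continuous a1 (lexx 1) wa)
      (slope_primitive a1 (lexx 1) wa)).
    by rewrite x1 andbT /a; lra.
  have wx : 0 < w x by rewrite wpos// sx ltW.
  apply: (@near_eq_is_derive _ _ _ (fun y => w y `^ q)).
    near=> y; rewrite /V Phi_gt0E ?addrK// wpos//; apply/andP; split.
      by near: y; exact: lt_nbhsr.
    by near: y; exact: lt_le_nbhsl.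
  apply: (is_derive_eq (@is_derive1_comp R (fun y => y `^ q) w x _ _
    (is_derive1_powR q wx) dw)).
  have Gw : Phi q (G x) = w x `^ (q - 1) * Phi q (G x / w x).
    by rewrite -PhiM// mulrC divfK// gt_eqF.
  by rewrite /r /slope Gw (Phi_gt0E _ wx); field; exact: lt0r_neq0.
have FTC : \int[mu]_(x in `[s, 1]) r x = V 1 - V s.
  rewrite /Rintegral (@continuous_FTC2 _ _ V)//.
  - move: cV => /(continuous_within_itvP _ s2)[_ ? ?]; split => //.
    by move=> x /dV[].
  - by move=> x /dV[_ <-]; rewrite derive1E.
have -> : w 1 `^ q = V 1 - V s.
  rewrite /V ws0 Phi0 subr0 Phi_gt0E ?addrK// wpos// s2 lexx//.
rewrite -FTC -RintegralZl//; last exact: integrable_continuous_within.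
(* The term with [sn * Phi q (w x)] is nonnegative and is dropped, whence an inequality. *)
apply: le_Rintegral => //.
- exact: integrable_continuous_within.
- by apply: integrableZ_EFin => //; exact: integrable_continuous_within.
move=> x /=; rewrite in_itv/= => /andP[sx x1].
rewrite /r ler_pM2l ?divr_gt0// gerBl mulr_ge0 ?(ltW sn0)// Phi_ge0// w_ge0//.
by rewrite in_itv/= x1 andbT (le_trans _ sx)// ltW.
Unshelve. all: by end_near. Qed.

(** The third hypothesis is (HF) at equal points, in terms of G. At the last zero of w it becomes
    the strict reverse of [flux_integrated], because G vanishes there; the first two keep that zero
    away from the endpoints. *)
Lemma flux_pos : w (-1) != 0 -> 0 < w 1 ->
  (forall x, x \in `[-1, 1] -> q / cs * \int[mu]_(t in `[x, 1]) Phi q (G t - G x) < w 1 `^ q) ->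
  forall x, x \in `[-1, 1] -> 0 < w x.
Proof.
move=> wm wp hyp x0 x0I; rewrite lt_neqAle w_ge0// andbT eq_sym; apply/negP => /eqP wx0.
pose Z := [set x | x \in `[-1, 1] /\ w x = 0].
have Z0 : Z x0 by [].
have ubZ : has_sup Z.
  split; first by exists x0.
  by exists 1 => x [+ _]; rewrite in_itv/= => /andP[].
pose s := sup Z.
have ubs z : Z z -> z <= s by move=> Zz; exact: (sup_upper_bound ubZ).
have s1 : -1 <= s.
  apply: le_trans (ubs _ Z0).
  by move: x0I; rewrite in_itv/= => /andP[].
have s2 : s <= 1.
  by apply: sup_le_ub => [|x [+ _]]; [exists x0|rewrite in_itv/= => /andP[]].
(* The zero set is closed, so it contains its supremum. *)
have ws : w s = 0.
  apply/eqP; rewrite -normr_eq0 eq_le normr_ge0 andbT; apply/ler_addgt0Pl => e e0.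
  rewrite addr0; have sI : `[-1, 1]%classic s by rewrite /= in_itv/= s1.
  move/subspace_continuousP : cw => /(_ s sI) /cvgrPdist_lt/(_ e e0).
  rewrite near_withinE => -[r /= r0 hr].
  have [z Zz sz] := sup_adherent r0 ubZ.
  have zs := ubs z Zz.
  have := hr z; rewrite /ball_ /from_subspace/= Zz.2 subr0 => h; apply/ltW/h; last exact: Zz.1.
  by rewrite ger0_norm ?subr_ge0// ltrBlDr addrC -ltrBlDr.
have s1' : -1 < s by rewrite lt_neqAle s1 andbT; apply: contra wm => /eqP ->; rewrite ws.
have s2' : s < 1.
  by rewrite lt_neqAle s2 andbT; apply/eqP => s1E; move: wp; rewrite -s1E ws ltxx.
have spos x : s < x <= 1 -> 0 < w x.
  move=> /andP[sx x1]; have xI : x \in `[-1, 1] by rewrite in_itv/= x1 (le_trans s1)// ltW.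
  rewrite lt_neqAle w_ge0// andbT eq_sym; apply/negP => /eqP wx.
  by move: sx; rewrite ltNge => /negP; apply; exact: ubs.
have Gs : G s = 0 by apply: flux_eq0 => //; rewrite s1'.
have := hyp s; rewrite in_itv/= s1 s2 Gs => /(_ isT); apply/negP; rewrite -leNgt.
under eq_Rintegral do rewrite subr0.
exact: flux_integrated.
Qed.

End Flux.

(** * From the weak formulation to the flux equation, and reading off (HF) *)

Section WeakSolutions.
Context {R : realType}.
Implicit Types (p q H a b x : R) (f u du : R -> R).
Local Notation mu := (@lebesgue_measure R).

(** Domination by 2^p (1 + |du|^p), integrable on a bounded interval. It makes the flux an L^1
    function, as du Bois-Reymond requires. *)
Lemma plap_integrable p du a b : 1 < p -> Lp p du -> `|a| <= 1 -> `|b| <= 1 ->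
  mu.-integrable (@Omega R) (EFin \o (fun x => plap p (du x * a + b))).
Proof.
move=> p1 ldu a1 b1; have mdu := Lp_measurable ldu.
have mO := @measurable_Omega R.
have p0 : 0 < p by rewrite (lt_trans _ p1).
have ip : mu.-integrable (@Omega R) (EFin \o (fun x => `|(du \_ (@Omega R)) x| `^ p)).
  apply: (@integrableS _ _ _ mu setT) => //.
  by apply: Lfun_integrable ldu; exact: ltW.
have i1 : mu.-integrable (@Omega R) (EFin \o cst 1).
  apply: measurable_bounded_integrable => //.
    by rewrite /Omega/= lebesgue_measure_itv/=; case: ifP; rewrite ltry.
  exact: bounded_cst.
have := integrableZ_EFin (2 `^ p) mO (integrableD_EFin mO i1 ip).
apply: le_integrable => //.
  apply/measurable_EFinP.
  rewrite (_ : (fun x => plap p (du x * a + b)) = Phi p \o (fun x => du x * a + b)); last first.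
    by apply/funext => x /=; rewrite plapE.
  apply: measurableT_comp; first by apply: continuous_measurable_fun; exact: continuous_Phi.
  by apply: measurable_funD => //; apply: measurable_funM.
move=> x Ox; rewrite /= plapE// lee_fin patchE mem_set//.
rewrite [leRHS]ger0_norm ?mulr_ge0 ?powR_ge0 ?addr_ge0 ?powR_ge0//.
(* The maximum with 1 makes the base 2m at least 1, so the exponent p - 1 can be raised to p. *)
set z := du x * a + b; pose m := Num.max 1 `|du x|.
have m1 : 1 <= m by rewrite /m le_max lexx.
have m20 : 0 <= 2 * m by lra.
have zm : `|z| <= 2 * m.
  apply: (le_trans (ler_normD _ _)); rewrite mulr_natl mulr2n lerD//; last exact: le_trans m1.
  by rewrite normrM (le_trans (ler_piMr _ a1))// /m le_max lexx orbT.
have h1 : `|Phi p z| <= `|z| `^ (p - 1).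
  rewrite /Phi normrM normr_sg ger0_norm ?powR_ge0// ler_piMr ?powR_ge0//.
  by case: eqP.
apply: (le_trans h1); apply: (@le_trans _ _ ((2 * m) `^ (p - 1))).
  by apply: ge0_ler_powR; rewrite ?nnegrE ?subr_ge0// ltW.
apply: (@le_trans _ _ ((2 * m) `^ p)).
  by apply: ler_powR; [lra|rewrite gerBl].
rewrite powRM// ?(le_trans ler01 m1)// ler_wpM2l ?powR_ge0// /m.
have [_|_] := leP 1 `|du x|; first by rewrite lerDr.
by rewrite powR1 lerDl powR_ge0.
Qed.

(** A set without a lower bound has infimum 0 by convention, so a positive infimum certifies that
    the set is bounded below. *)
Lemma inf_gt0_le (A : set R) x : 0 < inf A -> A x -> inf A <= x.
Proof.
move=> A0 Ax; apply: ge_inf => //; apply: contrapT => nlb.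
by move: A0; rewrite inf_out ?ltxx// => -[].
Qed.

Lemma HF_fun_gt0 p p' H a f x : HF p p' H a f -> x \in `[-1, 1] ->
  0 < HF_fun p p' H a f x x.
Proof.
move=> [_ A0] xI; move: (xI); rewrite in_itv/= => /andP[x1 x2].
have h := inf_gt0_le A0 (ex_intro2 _ _ x xI erefl).
apply: (lt_le_trans A0); apply: (le_trans h); apply: inf_gt0_le.
  exact: lt_le_trans h.
by exists x => //=; rewrite in_itv/= lexx.
Qed.

(** Integrating the right-hand side by parts turns it into -\int F phi', F being the primitive of f,
    so the flux plus F is orthogonal to every phi' and therefore constant. *)
Lemma weak_solution_flux p f u du H a : 1 < p ->
  mu.-integrable (@Omega R) (EFin \o f) -> W01p p u du ->
  (forall v dv, W01p p v dv ->
    \int[mu]_(x in Omega) ((u x + H) * plap p (du x * cos a + sin a) * dv x) =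
    \int[mu]_(x in Omega) (f x * v x)) ->
  exists c, {ae mu, forall x, -1 < x < 1 ->
    (u x + H) * Phi p (du x * cos a + sin a) = c - \int[mu]_(t in `[-1, x]) f t}.
Proof.
move=> p1 fO wu weak; have fi := integrable_oo_cc fO.
have [idu cu _ _] := W01p_primitive p1 wu.
have [_ [_ ldu _] _] := wu.
pose g x := (u x + H) * plap p (du x * cos a + sin a).
pose F x := \int[mu]_(t in `[-1, x]) f t.
have mO := @measurable_Omega R.
have sub : @Omega R `<=` `[-1, 1]%classic by exact: subset_itv_oo_cc.
have cw : {within `[-1, 1], continuous (fun x => u x + H)}.
  by move=> x; apply: cvgD; [exact: cu|exact: cvg_cst].
have gi : mu.-integrable (@Omega R) (EFin \o g).
  have pi_ : mu.-integrable (@Omega R) (EFin \o (fun x => plap p (du x * cos a + sin a))).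
    apply: plap_integrable => //; rewrite ler_norml.
      by rewrite cos_geN1 cos_le1.
    by rewrite sin_geN1 sin_le1.
  have /compact_bounded[M [_ hM]] := continuous_compact cw (@segment_compact _ (-1) 1).
  rewrite /g; under eq_fun do rewrite mulrC.
  apply: (@integrableM_bounded _ _ _ _ (`|M| + 1)) => //.
    apply: measurable_funS sub _ => //.
    by apply: subspace_continuous_measurable_fun.
  move=> x /sub xI; apply: (hM (`|M| + 1)); last by exists x.
  by rewrite (le_lt_trans (ler_norm M))// ltrDl.
have gic := integrable_oo_cc gi.
have cF : {within `[-1, 1], continuous F}.
  by apply: parameterized_integral_continuous.
have iF := integrable_continuous_within cF.
have gF : mu.-integrable `[-1, 1] (EFin \o (fun x => g x + F x)) by exact: integrableD_EFin.
have bd h phi : mu.-integrable `[-1, 1] (EFin \o h) -> continuous phi ->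
    mu.-integrable `[-1, 1] (EFin \o (fun x => h x * phi x)).
  move=> hi cphi; have [M _ hM] := continuous_bounded_itv (-1) 1 cphi.
  apply: (@integrableM_bounded _ _ _ _ M) => //; first exact: measurable_fun_continuous.
have toI h : mu.-integrable `[-1, 1] (EFin \o h) ->
    \int[mu]_(x in Omega) h x = \int[mu]_(x in `[-1, 1]) h x.
  move=> /(measurable_int mu)/measurable_EFinP mh.
  by rewrite -Rintegral_oo_cc//; apply: measurable_funS mh.
have [phi tphi|c hc] := du_Bois_Reymond gF.
  have [cphi cphi'] := test_continuous tphi.
  have := weak phi _ (test_W01p p1 tphi).
  rewrite (toI (fun x => g x * derive1 phi x)); last exact: bd.
  rewrite (toI (fun x => f x * phi x)); last exact: bd.
  rewrite (test_by_parts fi tphi) => e.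
  under eq_Rintegral do rewrite mulrDl.
  by rewrite RintegralD ?e ?addNr//; exact: bd.
exists c; apply: sub_ae hc => x /[apply]; rewrite /g plapE// => <-.
by rewrite addrK.
Qed.

End WeakSolutions.

Theorem theorem3p6 (R : realType) (p p' H varphi : R) (f : R -> R)
  (hp : 1 < p) (hpp' : p^-1 + p'^-1 = 1) (hH : 0 < H)
  (hvarphi : 0 < varphi < pi / 2)
  (hf : HF p p' H varphi f) :
  forall u : R -> R, weak_solution p H varphi f u -> C1_on (-1) 1 u.
Proof.
move=> u [du [wu u_ge weak]]; have [fO _] := hf.
have fi := integrable_oo_cc fO.
have p0 : 0 < p by rewrite (lt_trans _ hp).
have p'0 : p' != 0.
  apply/eqP => p'0; move: hpp'; rewrite p'0 invr0 addr0 => /eqP.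
  by rewrite invr_eq1 gt_eqF.
have pp' : p * p' = p + p'.
  have : p * p' * (p^-1 + p'^-1) = p * p' by rewrite hpp' mulr1.
  move=> <-; field; apply/andP; split => //; exact: lt0r_neq0.
have p1p' : p' * (p - 1) = p by move: pp'; lra.
(* Both powers in (HF), of H and inside the integral, are thus governed by the single exponent
   [p']. *)
have p'E : p / (p - 1) = p' by rewrite -[X in X / _]p1p' mulfK// subr_eq0 gt_eqF.
have q1 : 1 < p'.
  by rewrite -p'E ltr_pdivlMr ?subr_gt0// mul1r ltrBlDr ltrDl.
have conj : (p - 1) * (p' - 1) = 1 by move: pp'; lra.
have [v0 v1] := andP hvarphi.
have cs0 : 0 < cos varphi by apply: cos_gt0_pihalf; rewrite v1 andbT; lra.
have sn0 : 0 < sin varphi by apply: sin_gt0_pihalf; rewrite v0.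
have [idu cu u1 uE] := W01p_primitive hp wu.
have [c flux] := weak_solution_flux hp fO wu weak.
pose w x := u x + H; pose G x := c - \int[lebesgue_measure]_(t in `[-1, x]) f t.
have cw : {within `[-1, 1], continuous w}.
  by move=> x; apply: cvgD; [exact: cu|exact: cvg_cst].
have cG : {within `[-1, 1], continuous G}.
  have cF : {within `[-1, 1], continuous
      (fun x => \int[lebesgue_measure]_(t in `[-1, x]) f t)}.
    exact: parameterized_integral_continuous.
  by move=> x; apply: cvgB; [exact: cvg_cst|exact: cF].
have w_ge0 x : x \in `[-1, 1] -> 0 <= w x by move=> /u_ge; rewrite /w; lra.
have w_prim x y : -1 <= x -> x <= y -> y <= 1 ->
    w y - w x = \int[lebesgue_measure]_(t in `[x, y]) du t.
  move=> x1 xy y1; rewrite /w !uE ?in_itv/= ?x1 ?y1 ?(le_trans x1)//; last exact: le_trans y1.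
  rewrite (Rintegral_itv_cat x1 xy); first ring.
  by apply: integrableS idu => //; apply: subset_itv; rewrite bnd_simp.
have wm1 : w (-1) != 0.
  rewrite /w uE ?set_itv1 ?Rintegral_set1 ?add0r ?gt_eqF//.
  by rewrite in_itv/= lexx/=; lra.
have w1 : w 1 = H by rewrite /w u1 add0r.
have wpos : forall x, x \in `[-1, 1] -> 0 < w x.
  apply: (flux_pos hp q1 conj cs0 sn0 (sin_le1 _) idu cw cG w_ge0 w_prim flux wm1).
    by rewrite w1.
  move=> x xI; rewrite w1; have := HF_fun_gt0 hf xI; rewrite /HF_fun p'E.
  move: xI; rewrite in_itv/= => /andP[x1 x2].
  have -> : p / ((p - 1) * cos varphi) = p' / cos varphi by rewrite -p'E -mulrA -invfM.
  (* The integral of f from x to t is G(x) - G(t), and oddness of [Phi] brings out the sign. *)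
  have -> : \int[lebesgue_measure]_(t in `[x, 1])
        Phi p' (\int[lebesgue_measure]_(s in `[x, t]) f s) =
      \int[lebesgue_measure]_(t in `[x, 1]) (- 1 * Phi p' (G t - G x)).
    apply: eq_Rintegral => t; rewrite inE/= in_itv/= => /andP[xt t1].
    rewrite mulN1r -PhiN; congr (Phi _ _); rewrite /G (Rintegral_itv_cat x1 xt); first ring.
    by apply: integrableS fi => //; apply: subset_itv; rewrite bnd_simp.
  rewrite RintegralZl//; first lra.
  apply: integrable_continuous_within.
  have cGx : {within `[x, 1], continuous G}.
    by apply: continuous_subspaceW cG; apply: subset_itv; rewrite bnd_simp.
  apply: (@continuous_within_comp _ _ _ (fun t => G t - G x)); first exact: continuous_Phi.
  by move=> t; apply: cvgB; [exact: cGx|exact: cvg_cst].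
have wpos' x : -1 <= x <= 1 -> 0 < w x by move=> xI; apply: wpos; rewrite in_itv.
have ck := slope_continuous (sn := sin varphi) (cs := cos varphi) q1 cw cG
  (lexx (-1)) (lexx 1) wpos'.
(* With w positive on all of [-1, 1], [slope] is continuous up to both endpoints, and u has the same
   increments as w. *)
exists (slope p' (cos varphi) (sin varphi) w G) => //.
apply: (diff_quotient_primitive ck) => x y x1 xy y1.
rewrite -(slope_primitive q1 conj cs0 idu cw cG w_prim flux (lexx (-1)) (lexx 1) wpos' x1 xy y1).
by rewrite /w; ring.
Qed.
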